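(* Let $(M,L)$, $\dim M\geq 3$, be an $h$-isotropic Finsler manifold admitting a concurrent $\pi$-vector field $\overline{\zeta}$. Then: (a) the $h$-curvature tensor $R$ of the Cartan connection vanishes; (b) if $(M,L)$ is a Berwald manifold, then it is a flat Riemannian manifold.
   Context: $M$ is a real paracompact smooth manifold of finite dimension $n$; all objects are $C^\infty$. $\pi:\mathcal{T}M\to M$ is the bundle of nonzero tangent vectors, $\pi^{-1}(TM)\to\mathcal{T}M$ the pullback of $TM$ by $\pi$. Sections of $\pi^{-1}(TM)$ are called $\pi$-vector fields, are written with bars, and form the module $\mathfrak{X}(\pi(M))$. The fundamental $\pi$-vector field is $\overline{\eta}(u)=(u,u)$. $\rho:T(\mathcal{T}M)\to\pi^{-1}(TM)$ is $\rho=(\pi_{\mathcal{T}M},d\pi)$, and $\gamma:\pi^{-1}(TM)\to T(\mathcal{T}M)$ is the vertical lift $\gamma(u,v)=j_u(v)$, with $j_u:T_{\pi(u)}M\to T_u(T_{\pi(u)}M)$ the natural isomorphism. $(M,L)$ is a Finsler manifold with Finsler metric $g$ on $\pi^{-1}(TM)$ (locally $g_{ij}=\frac12\partial^2L^2/\partial y^i\partial y^j$). For a linear connection $D$ on $\pi^{-1}(TM)$ its connection map is $K(X)=D_X\overline{\eta}$; $D$ is regular if $T_u(\mathcal{T}M)=V_u(\mathcal{T}M)\oplus\ker K_u$ for all $u$ ($V$ the vertical bundle), and then its horizontal map is $\beta:=(\rho|_{\ker K})^{-1}$. The torsion is $\mathbf{T}(X,Y)=D_X\rho Y-D_Y\rho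 X-\rho[X,Y]$, with $Q(\overline{X},\overline{Y})=\mathbf{T}(\beta\overline{X},\beta\overline{Y})$ and $(h)hv$-torsion $T(\overline{X},\overline{Y})=\mathbf{T}(\gamma\overline{X},\beta\overline{Y})$. The curvature is $\mathbf{K}(X,Y)\rho Z=-D_XD_Y\rho Z+D_YD_X\rho Z+D_{[X,Y]}\rho Z$, with $h$-curvature $R(\overline{X},\overline{Y})\overline{Z}=\mathbf{K}(\beta\overline{X},\beta\overline{Y})\overline{Z}$. The Cartan connection $\nabla$ is the unique regular connection on $\pi^{-1}(TM)$ with $\nabla g=0$, $Q=0$ and $g(T(\overline{X},\overline{Y}),\overline{Z})=g(T(\overline{X},\overline{Z}),\overline{Y})$. Below $\beta,T,R$ are those of $\nabla$. A $\pi$-vector field $\overline{\zeta}$ is concurrent if $\nabla_{\beta\overline{X}}\overline{\zeta}=-\overline{X}$ and $\nabla_{\gamma\overline{X}}\overline{\zeta}=0$ for all $\overline{X}$. $(M,L)$, $\dim M\geq3$, is $h$-isotropic if there exists a scalar $k_o$ such that $R(\overline{X},\overline{Y})\overline{Z}=k_o\{g(\overline{X},\overline{Z})\overline{Y}-g(\overline{Y},\overline{Z})\overline{X}\}$ for all $\overline{X},\overline{Y},\overline{Z}$. $(M,L)$ is a Berwald manifold if $\nabla_{\beta\overline{X}}T=0$ for all $\overline{X}$; it is Riemannian if $g(x,y)$ is independent of $y$ (equivalently $T=0$). *)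

(* Defs.v *)
From HB Require Import structures.
From mathcomp Require Import all_boot all_order all_algebra.
From mathcomp Require Import all_classical all_reals all_analysis.
Set Implicit Arguments.
Unset Strict Implicit.
Unset Printing Implicit Defensive.
Import Order.TTheory GRing.Theory Num.Theory.
Import numFieldNormedType.Exports.
Local Open Scope classical_set_scope.
Local Open Scope ring_scope.

(** * Smooth manifolds *)

Fixpoint Ck (R : realType) (V W : normedModType R) (k : nat) (A : set V)
    (f : V -> W) : Prop :=
  if k is k'.+1 then
    (forall x, A x -> differentiable f x) /\
    (forall v, Ck k' A (fun x => 'D_v f x))
  else forall x, A x -> {for x, continuous f}.

(* Meant for open sets A. *)
Definition smooth_on (R : realType) (V W : normedModType R) (A : set V)
  (f : V -> W) : Prop := forall k, Ck k A f.

(* Every point x comes with a preferred chart [chart_at x].  The tangent space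
   T_x M is modelled by 'rV[R]_n, a row vector standing for the tangent vector
   that has these components in the preferred chart at x. *)
Record atlas (R : realType) (n : nat) (M : Type) := Atlas {
  chart_index : Type;
  chart_dom : chart_index -> set M;
  chart_map : chart_index -> M -> 'rV[R]_n;
  chart_at : M -> chart_index
}.

(* Local representative f \o (chart_map i)^-1 of a function f on M; it is 0
   outside the image of the chart. *)
Definition local_rep (R : realType) (n : nat) (M : Type) (A : atlas R n M)
    (V : zmodType) (i : chart_index A) (f : M -> V) (a : 'rV[R]_n) : V :=
  if pselect (exists p, chart_dom i p /\ chart_map i p = a) is left h
  then f (projT1 (cid h)) else 0.

Definition paracompact (M : topologicalType) : Prop :=
  forall F : set (set M),
    (forall U, F U -> open U) -> (forall x, exists2 U, F U & U x) ->
  exists G : set (set M),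
    [/\ forall U, G U -> open U,
        forall x, exists2 U, G U & U x,
        forall U, G U -> exists2 U', F U' & U `<=` U' &
        forall x : M, exists2 N, nbhs x N &
          finite_set [set U | G U /\ U `&` N !=set0]].

Definition smooth_atlas (R : realType) (n : nat) (M : topologicalType)
    (A : atlas R n M) : Prop :=
  [/\ forall x, chart_dom (chart_at A x) x,
      forall i : chart_index A, open (chart_dom i),
      forall (i : chart_index A) x y, chart_dom i x -> chart_dom i y ->
        chart_map i x = chart_map i y -> x = y,
      (forall (i : chart_index A) x, chart_dom i x ->
         {for x, continuous (chart_map i)}) /\
      (forall (i : chart_index A) U, open U -> U `<=` chart_dom i ->
         open (chart_map i @` U)) &
      forall i j : chart_index A,
        smooth_on (chart_map i @` (chart_dom i `&` chart_dom j))
                  (local_rep i (chart_map j))].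

Definition smooth_manifold (R : realType) (n : nat) (M : topologicalType)
    (A : atlas R n M) : Prop :=
  [/\ hausdorff_space M, paracompact M & smooth_atlas A].

Definition smooth_fun (R : realType) (n : nat) (M : Type) (A : atlas R n M)
    (f : M -> R) : Prop :=
  forall i : chart_index A,
    smooth_on (chart_map i @` chart_dom i) (local_rep i (f : M -> R^o)).

(** * Tangent vectors *)

(* Components, in the chart i, of the tangent vector v at x. *)
Definition tcoord (R : realType) (n : nat) (M : Type) (A : atlas R n M)
    (i : chart_index A) (x : M) (v : 'rV[R]_n) : 'rV[R]_n :=
  'D_v (local_rep (chart_at A x) (chart_map i)) (chart_map (chart_at A x) x).

(* Differential of f : N -> M at p. *)
Definition tmap (R : realType) (m n : nat) (N M : Type) (B : atlas R m N)
    (A : atlas R n M) (f : N -> M) (p : N) (v : 'rV[R]_m) : 'rV[R]_n :=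
  'D_v (local_rep (chart_at B p) (chart_map (chart_at A (f p)) \o f))
    (chart_map (chart_at B p) p).

(* Derivative v(f) of a real function f along the tangent vector v at x. *)
Definition dfun (R : realType) (n : nat) (M : Type) (A : atlas R n M)
    (f : M -> R) (x : M) (v : 'rV[R]_n) : R :=
  'D_v (local_rep (chart_at A x) (f : M -> R^o)) (chart_map (chart_at A x) x).

(* Smooth sections of the pullback bundle f^*(TM), where s p is a tangent
   vector at f p. *)
Definition smooth_section (R : realType) (m n : nat) (N M : Type)
    (B : atlas R m N) (A : atlas R n M) (f : N -> M) (s : N -> 'rV[R]_n) :
    Prop :=
  forall (i : chart_index B) (j : chart_index A),
    smooth_on (chart_map i @` (chart_dom i `&` f @^-1` chart_dom j))
              (local_rep i (fun p => tcoord j (f p) (s p))).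

Definition smooth_vfield (R : realType) (n : nat) (M : Type) (A : atlas R n M)
    (X : M -> 'rV[R]_n) : Prop := smooth_section A A id X.

(* [X, Y] = X^i d_i Y - Y^i d_i X, computed at x in the preferred chart. *)
Definition bracket (R : realType) (n : nat) (M : Type) (A : atlas R n M)
    (X Y : M -> 'rV[R]_n) (x : M) : 'rV[R]_n :=
  let c := chart_at A x in
  let loc (Z : M -> 'rV[R]_n) := local_rep c (fun p => tcoord c p (Z p)) in
  'D_(X x) (loc Y) (chart_map c x) - 'D_(Y x) (loc X) (chart_map c x).

(** * Linear connections on a pullback bundle f^*(TM) *)

(* D s p v is the covariant derivative at p of the section s along the tangent
   vector v; only its values on smooth sections matter. *)
Definition linear_connection (R : realType) (m n : nat) (N M : Type)
    (B : atlas R m N) (A : atlas R n M) (f : N -> M)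
    (D : (N -> 'rV[R]_n) -> N -> 'rV[R]_m -> 'rV[R]_n) : Prop :=
  [/\ forall s, smooth_section B A f s -> forall p a v w,
        D s p (a *: v + w) = a *: D s p v + D s p w,
      forall s t, smooth_section B A f s -> smooth_section B A f t ->
        forall p v, D (fun q => s q + t q) p v = D s p v + D t p v,
      forall h s, smooth_fun B h -> smooth_section B A f s -> forall p v,
        D (fun q => h q *: s q) p v = dfun B h p v *: s p + h p *: D s p v &
      forall X s, smooth_vfield B X -> smooth_section B A f s ->
        smooth_section B A f (fun p => D s p (X p))].

Definition metric_connection (R : realType) (m n : nat) (N M : Type)
    (B : atlas R m N) (A : atlas R n M) (f : N -> M)
    (D : (N -> 'rV[R]_n) -> N -> 'rV[R]_m -> 'rV[R]_n)
    (g : N -> 'rV[R]_n -> 'rV[R]_n -> R) : Prop :=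
  forall X s t, smooth_vfield B X -> smooth_section B A f s ->
    smooth_section B A f t -> forall p,
    dfun B (fun q => g q (s q) (t q)) p (X p) =
    g p (D s p (X p)) (t p) + g p (s p) (D t p (X p)).

Definition torsion (R : realType) (m n : nat) (N M : Type)
    (B : atlas R m N) (A : atlas R n M) (f : N -> M)
    (D : (N -> 'rV[R]_n) -> N -> 'rV[R]_m -> 'rV[R]_n)
    (X Y : N -> 'rV[R]_m) (p : N) : 'rV[R]_n :=
  D (fun q => tmap B A f q (Y q)) p (X p)
  - D (fun q => tmap B A f q (X q)) p (Y p)
  - tmap B A f p (bracket B X Y p).

Definition curvature (R : realType) (m n : nat) (N : Type) (B : atlas R m N)
    (D : (N -> 'rV[R]_n) -> N -> 'rV[R]_m -> 'rV[R]_n)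
    (X Y : N -> 'rV[R]_m) (s : N -> 'rV[R]_n) (p : N) : 'rV[R]_n :=
  - D (fun q => D s q (Y q)) p (X p)
  + D (fun q => D s q (X q)) p (Y p)
  + D s p (bracket B X Y p).

Definition levi_civita (R : realType) (n : nat) (M : Type) (A : atlas R n M)
    (h : M -> 'rV[R]_n -> 'rV[R]_n -> R)
    (D : (M -> 'rV[R]_n) -> M -> 'rV[R]_n -> 'rV[R]_n) : Prop :=
  [/\ linear_connection A A id D,
      metric_connection A A id D h &
      forall X Y, smooth_vfield A X -> smooth_vfield A Y ->
        forall x, torsion A A id D X Y x = 0].

(** * The bundle of nonzero tangent vectors *)

Definition slit (R : realType) (n : nat) (M : Type) : Type :=
  {u : M * 'rV[R]_n | u.2 != 0}.

Definition slit_proj (R : realType) (n : nat) (M : Type) (u : slit R n M) : M :=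
  (val u).1.

(* The fundamental section; also the fibre coordinate y of u = (x, y). *)
Definition eta (R : realType) (n : nat) (M : Type) (u : slit R n M) :
  'rV[R]_n := (val u).2.

(* The chart (x, y) of TM induced by the chart i of M. *)
Definition tangent_chart (R : realType) (n : nat) (M : Type)
    (A : atlas R n M) (i : chart_index A) (u : M * 'rV[R]_n) :
    'rV[R]_(n + n) :=
  row_mx (chart_map i u.1) (tcoord i u.1 u.2).

Definition slit_atlas (R : realType) (n : nat) (M : Type) (A : atlas R n M) :
    atlas R (n + n) (slit R n M) :=
  {| chart_index := chart_index A;
     chart_dom := fun i => @slit_proj R n M @^-1` chart_dom i;
     chart_map := fun i u => tangent_chart i (val u);
     chart_at := fun u => chart_at A (slit_proj u) |}.

Definition smooth_pi_vfield (R : realType) (n : nat) (M : Type)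
    (A : atlas R n M) (X : slit R n M -> 'rV[R]_n) : Prop :=
  smooth_section (slit_atlas A) A (@slit_proj R n M) X.

Definition rho (R : realType) (n : nat) (M : Type) (A : atlas R n M)
    (u : slit R n M) (w : 'rV[R]_(n + n)) : 'rV[R]_n :=
  tmap (slit_atlas A) A (@slit_proj R n M) u w.

(* Vertical lift: the differential at y, in the direction v, of the inclusion
   of T_x M into TM. *)
Definition gamma (R : realType) (n : nat) (M : Type) (A : atlas R n M)
    (u : slit R n M) (v : 'rV[R]_n) : 'rV[R]_(n + n) :=
  let x := slit_proj u in
  'D_v (fun y => tangent_chart (chart_at A x) (x, y)) (eta u).

(** * Finsler metrics *)

(* Half the second derivative of L^2 along the vector space T_x M. *)
Definition finsler_metric (R : realType) (n : nat) (M : Type)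
    (L : M -> 'rV[R]_n -> R) (u : slit R n M) (v w : 'rV[R]_n) : R :=
  let E : 'rV[R]_n -> R^o := fun y => L (slit_proj u) y ^+ 2 in
  2^-1 * 'D_v (fun y => 'D_w E y) (eta u).

(* Continuity of L on the zero section is a consequence of the homogeneity and
   of the smoothness on the nonzero vectors. *)
Definition finsler (R : realType) (n : nat) (M : Type) (A : atlas R n M)
    (L : M -> 'rV[R]_n -> R) : Prop :=
  [/\ smooth_fun (slit_atlas A) (fun u => L (slit_proj u) (eta u)),
      forall x (a : R) v, 0 <= a -> L x (a *: v) = a * L x v,
      forall x v, v != 0 -> 0 < L x v &
      forall (u : slit R n M) v, v != 0 -> 0 < finsler_metric L u v v].

(** * Regular connections and the Cartan connection *)

Definition connection_map (R : realType) (n : nat) (M : Type)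
    (D : (slit R n M -> 'rV[R]_n) -> slit R n M -> 'rV[R]_(n + n) -> 'rV[R]_n)
    (u : slit R n M) (w : 'rV[R]_(n + n)) : 'rV[R]_n :=
  D (@eta R n M) u w.

(* The tangent space at u is the direct sum of the vertical space, i.e. the
   kernel of the differential of the projection, and of the kernel of the
   connection map. *)
Definition regular (R : realType) (n : nat) (M : Type) (A : atlas R n M)
    (D : (slit R n M -> 'rV[R]_n) -> slit R n M -> 'rV[R]_(n + n) -> 'rV[R]_n) :
    Prop :=
  forall u,
    (forall w, exists v k,
       [/\ rho A u v = 0, connection_map D u k = 0 & w = v + k]) /\
    (forall w, rho A u w = 0 -> connection_map D u w = 0 -> w = 0).

(* The inverse of the restriction of rho to the kernel of the connection map;
   meaningful for a regular connection. *)
Definition beta (R : realType) (n : nat) (M : Type) (A : atlas R n M)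
    (D : (slit R n M -> 'rV[R]_n) -> slit R n M -> 'rV[R]_(n + n) -> 'rV[R]_n)
    (u : slit R n M) (v : 'rV[R]_n) : 'rV[R]_(n + n) :=
  xget 0 [set w | connection_map D u w = 0 /\ rho A u w = v].

Definition h_torsion (R : realType) (n : nat) (M : Type) (A : atlas R n M)
    (D : (slit R n M -> 'rV[R]_n) -> slit R n M -> 'rV[R]_(n + n) -> 'rV[R]_n)
    (X Y : slit R n M -> 'rV[R]_n) : slit R n M -> 'rV[R]_n :=
  torsion (slit_atlas A) A (@slit_proj R n M) D
    (fun u => beta A D u (X u)) (fun u => beta A D u (Y u)).

Definition hv_torsion (R : realType) (n : nat) (M : Type) (A : atlas R n M)
    (D : (slit R n M -> 'rV[R]_n) -> slit R n M -> 'rV[R]_(n + n) -> 'rV[R]_n)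
    (X Y : slit R n M -> 'rV[R]_n) : slit R n M -> 'rV[R]_n :=
  torsion (slit_atlas A) A (@slit_proj R n M) D
    (fun u => gamma A u (X u)) (fun u => beta A D u (Y u)).

Definition h_curvature (R : realType) (n : nat) (M : Type) (A : atlas R n M)
    (D : (slit R n M -> 'rV[R]_n) -> slit R n M -> 'rV[R]_(n + n) -> 'rV[R]_n)
    (X Y Z : slit R n M -> 'rV[R]_n) : slit R n M -> 'rV[R]_n :=
  curvature (slit_atlas A) D
    (fun u => beta A D u (X u)) (fun u => beta A D u (Y u)) Z.

Definition cartan_connection (R : realType) (n : nat) (M : Type)
    (A : atlas R n M) (L : M -> 'rV[R]_n -> R)
    (D : (slit R n M -> 'rV[R]_n) -> slit R n M -> 'rV[R]_(n + n) -> 'rV[R]_n) :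
    Prop :=
  [/\ linear_connection (slit_atlas A) A (@slit_proj R n M) D,
      regular A D,
      metric_connection (slit_atlas A) A (@slit_proj R n M) D
        (finsler_metric L),
      forall X Y, smooth_pi_vfield A X -> smooth_pi_vfield A Y ->
        forall u, h_torsion A D X Y u = 0 &
      forall X Y Z, smooth_pi_vfield A X -> smooth_pi_vfield A Y ->
        smooth_pi_vfield A Z -> forall u,
        finsler_metric L u (hv_torsion A D X Y u) (Z u) =
        finsler_metric L u (hv_torsion A D X Z u) (Y u)].

(** * Special Finsler manifolds *)

Definition concurrent (R : realType) (n : nat) (M : Type) (A : atlas R n M)
    (D : (slit R n M -> 'rV[R]_n) -> slit R n M -> 'rV[R]_(n + n) -> 'rV[R]_n)
    (zeta : slit R n M -> 'rV[R]_n) : Prop :=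
  smooth_pi_vfield A zeta /\
  forall X, smooth_pi_vfield A X -> forall u,
    D zeta u (beta A D u (X u)) = - X u /\ D zeta u (gamma A u (X u)) = 0.

(* The scalar k0 is a smooth function of (x, y), not assumed constant. *)
Definition h_isotropic (R : realType) (n : nat) (M : Type) (A : atlas R n M)
    (L : M -> 'rV[R]_n -> R)
    (D : (slit R n M -> 'rV[R]_n) -> slit R n M -> 'rV[R]_(n + n) -> 'rV[R]_n) :
    Prop :=
  exists2 k0 : slit R n M -> R, smooth_fun (slit_atlas A) k0 &
    forall X Y Z, smooth_pi_vfield A X -> smooth_pi_vfield A Y ->
      smooth_pi_vfield A Z -> forall u,
      h_curvature A D X Y Z u =
      k0 u *: (finsler_metric L u (X u) (Z u) *: Y u
               - finsler_metric L u (Y u) (Z u) *: X u).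

(* The equation says that (D_{beta X} T)(Y, Z) = 0. *)
Definition berwald (R : realType) (n : nat) (M : Type) (A : atlas R n M)
    (D : (slit R n M -> 'rV[R]_n) -> slit R n M -> 'rV[R]_(n + n) -> 'rV[R]_n) :
    Prop :=
  forall X Y Z, smooth_pi_vfield A X -> smooth_pi_vfield A Y ->
    smooth_pi_vfield A Z -> forall u,
    let DX (s : slit R n M -> 'rV[R]_n) q := D s q (beta A D q (X q)) in
    DX (hv_torsion A D Y Z) u - hv_torsion A D (DX Y) Z u
    - hv_torsion A D Y (DX Z) u = 0.

Definition riemannian (R : realType) (n : nat) (M : Type)
    (L : M -> 'rV[R]_n -> R) : Prop :=
  forall u u' : slit R n M, slit_proj u = slit_proj u' ->
    finsler_metric L u = finsler_metric L u'.

(* g descends to a metric h on M whose Levi-Civita connection has zero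
   curvature. *)
Definition flat_riemannian (R : realType) (n : nat) (M : Type)
    (A : atlas R n M) (L : M -> 'rV[R]_n -> R) : Prop :=
  riemannian L /\
  exists h : M -> 'rV[R]_n -> 'rV[R]_n -> R,
    (forall u : slit R n M, finsler_metric L u = h (slit_proj u)) /\
    exists2 D : (M -> 'rV[R]_n) -> M -> 'rV[R]_n -> 'rV[R]_n,
      levi_civita A h D &
      forall X Y Z, smooth_vfield A X -> smooth_vfield A Y ->
        smooth_vfield A Z -> forall x, curvature A D X Y Z x = 0.

(* Main.v *)
From HB Require Import structures.
From mathcomp Require Import all_boot all_order all_algebra.
From mathcomp Require Import all_classical all_reals all_analysis.
From mathcomp Require Import ring lra.
Require Import Defs.
Set Implicit Arguments.
Unset Strict Implicit.
Unset Printing Implicit Defensive.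
Import Order.TTheory GRing.Theory Num.Theory.
Import numFieldNormedType.Exports.
Local Open Scope classical_set_scope.
Local Open Scope ring_scope.

(** Write D for the Cartan connection, R for its h-curvature, T for its
    (h)hv-torsion and zeta for the concurrent field.

    Part (a). A tangent vector w of the slit bundle is the sum of the horizontal
    lift of rho w and of a vertical vector, so that concurrency says
    D_w zeta = - rho w ([concurrent_derivative]).  Substituting this in the
    definition of the curvature turns R(X, Y) zeta into the horizontal torsion
    Q(X, Y) = 0 ([curvature_concurrent]).  Isotropy then reads
    k0 (g(X, zeta) Y - g(Y, zeta) X) = 0; where k0 <> 0, the choice X = zeta and
    Y independent of zeta gives zeta = 0.  This cannot happen on an open set,
    because the derivative of g(X, zeta) along the lift of X would then be both
    0 and - g(X, X).  Hence k0 = 0 ([isotropy_factor_eq0]).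

    Part (b). Call basic a field that comes from M.  The function g(zeta, zeta)
    has no vertical derivative, and the fibres are connected, so it comes from
    M; then so do its horizontal derivatives - 2 g(x, zeta) along basic fields x.
    The vertical derivative of g(x, zeta) is g(T(V, x), zeta), and the symmetry
    of T gives T(V, zeta) = 0 ([hv_torsion_concurrent]).  On a Berwald manifold
    the horizontal derivative of this identity is T(V, X) = 0
    ([hv_torsion_berwald]).  Now T(V, x) is the vertical derivative of the basic
    field x, so basic fields are vertically parallel and g is constant along the
    fibres ([metric_basic]): the manifold is Riemannian.  The argument that
    proves the uniqueness of a Levi-Civita connection shows that the horizontal
    derivative of a basic field along a basic field is basic
    ([connection_beta_basic]).  So D descends to a connection of M, which is
    metric and torsion-free, and whose curvature is R = 0.

    The rest of the file is the calculus on manifolds that these arguments use: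
    stability of smoothness under the usual operations, symmetry of second
    derivatives, independence of charts, bump functions (by which every tangent
    vector extends to a global vector field), and the smoothness of horizontal
    lifts ([smooth_beta]). *)

(** * Derivatives in normed spaces *)

Section Calculus.
Context {R : realType}.
Implicit Types (U V W : normedModType R).

(** The difference g - f is 0 near x, hence has differential 0 at x. *)
Lemma near_eq_differentiable V W (f g : V -> W) (x : V) :
  (\forall y \near x, f y = g y) -> differentiable f x -> differentiable g x.
Proof.
move=> fg df.
suff d0 : differentiable (fun y => g y - f y) x.
  have -> : g = f + (fun y => g y - f y).
    by apply/funext => y; rewrite -[RHS]/(f y + (g y - f y)) addrC subrK.
  exact: differentiableD.
apply/diffP.
apply: (@getPex _ (fun (df : {linear V -> W}) => continuous df /\
  forall y, (fun y => g y - f y) y = (fun y => g y - f y) (lim (nbhs x)) +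
   df (y - lim (nbhs x)) +o_(y \near x) (y - lim (nbhs x)))).
exists (\0 : {linear V -> W}); split; first exact: cst_continuous.
rewrite lim_id//.
apply: eqaddoEx => y.
have gfx : g x - f x = 0 by rewrite (nbhs_singleton fg) subrr.
rewrite gfx /= addr0 add0r.
rewrite littleoE //.
move=> e e0; near=> z.
have -> : f z = g z by near: z.
by rewrite subrr normr0 mulr_ge0// ltW.
Unshelve. all: by end_near. Qed.

Lemma differentiable_coords V m (f : V -> 'rV[R]_m) x :
  (forall j, differentiable (fun y => f y 0 j : R^o) x) -> differentiable f x.
Proof.
move=> df.
have -> : f = \sum_(j < m) (fun y => f y 0 j *: delta_mx 0 j).
  apply/funext => y; rewrite fct_sumE; exact: row_sum_delta.
by apply: differentiable_sum => j; exact: differentiableZl.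
Qed.

Lemma derive_coord V m (f : V -> 'rV[R]_m) x v j :
  differentiable f x -> ('D_v f x) 0 j = 'D_v (fun y => f y 0 j : R^o) x.
Proof.
move=> df; rewrite derive_mx ?mxE//; exact: diff_derivable.
Qed.

Lemma derive_comp U V W (f : U -> V) (g : V -> W) x v :
  differentiable f x -> differentiable g (f x) ->
  'D_v (g \o f) x = 'D_('D_v f x) g (f x).
Proof.
move=> df dg; have dgf := differentiable_comp df dg.
by rewrite (deriveE v dgf) (deriveE _ dg) (deriveE v df) diff_comp.
Qed.

Lemma derive_linear V W (f : V -> W) x a v w : differentiable f x ->
  'D_(a *: v + w) f x = a *: 'D_v f x + 'D_w f x.
Proof. by move=> df; rewrite !deriveE// linearP. Qed.

Lemma derive_sumv V W (f : V -> W) x (I : finType) (F : I -> V) :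
  differentiable f x -> 'D_(\sum_i F i) f x = \sum_i 'D_(F i) f x.
Proof.
move=> df; rewrite deriveE// linear_sum; apply: eq_bigr => i _.
by rewrite deriveE.
Qed.

Lemma derive_scale V W (f : V -> W) x a v : differentiable f x ->
  'D_(a *: v) f x = a *: 'D_v f x.
Proof. by move=> df; rewrite !deriveE// linearZ. Qed.

Lemma scale_is_bilinear W :
  bilinear_for
    (GRing.Scale.Law.clone _ _ *:%R _) (GRing.Scale.Law.clone _ _ *:%R _)
    (fun (a : R^o) (w : W) => a *: w).
Proof.
split=> [w|a] b x y /=.
- by rewrite scalerDl scalerA.
- by rewrite scalerDr !scalerA mulrC.
Qed.

(** Leibniz rule for a scalar function times a vector-valued one. *)
Lemma is_diffZl V W (f df : V -> R^o) (g dg : V -> W) x :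
  is_diff x f df -> is_diff x g dg ->
  is_diff x (fun y => f y *: g y) (fun h => f x *: dg h + df h *: g x).
Proof.
move=> fx gx.
pose bM := bilinear_isBilinear.Build R R^o W W _ _ _ (scale_is_bilinear W).
pose b : {bilinear R^o -> W -> W} := HB.pack (fun (a : R^o) (w : W) => a *: w) bM.
have cb : continuous (fun p : R^o * W => b p.1 p.2).
  by move=> p; exact: scale_continuous.
have db : is_diff (f x, g x) (fun p : R^o * W => b p.1 p.2)
    (fun q => b (f x) q.2 + b q.1 (g x)).
  by apply: DiffDef; [exact: differentiable_bilin|rewrite diff_bilin].
exact: is_diff_comp (is_diff_pair fx gx) db.
Qed.

End Calculus.

(** * Functions of class C^k on an open set *)

Section CkTheory.
Context {R : realType}.
Implicit Types (U V W : normedModType R).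

(** All the conditions in [Ck] are imposed at the points of A: membership in C^k
   can be tested with a different neighbourhood around each point. *)
Lemma Ck_pt V W k (A : set V) (f : V -> W) :
  Ck k A f <-> forall x, A x -> Ck k [set x] f.
Proof.
elim: k f => [|k IH] f /=.
  by split=> [h x Ax y -> | h x Ax]; [exact: h|exact: (h x Ax x)].
split=> [[h1 h2] x Ax|h].
  split=> [y ->|v]; first exact: h1.
  by move/IH: (h2 v); exact.
split=> [x Ax|v]; first by case: (h x Ax) => h1 _; exact: (h1 x).
by apply/IH => x Ax; case: (h x Ax).
Qed.

Lemma Ck_sub V W k (A B : set V) (f : V -> W) : B `<=` A -> Ck k A f ->
  Ck k B f.
Proof. by move=> BA /Ck_pt h; apply/Ck_pt => x /BA; exact: h. Qed.

Lemma Ck_le V W k (A : set V) (f : V -> W) : Ck k.+1 A f -> Ck k A f.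
Proof.
elim: k f => [|k IH] f; last first.
  by move=> [h1 h2]; split=> // v; exact: IH.
by move=> [h _] x Ax; apply: differentiable_continuous; exact: h.
Qed.

Lemma Ck_eq V W k (A : set V) (f g : V -> W) : open A ->
  (forall x, A x -> f x = g x) -> Ck k A f -> Ck k A g.
Proof.
move=> oA; elim: k f g => [|k IH] f g fg.
  move=> h x Ax.
  have fgx : {near x, f =1 g} by near=> z; apply: fg; near: z; exact: open_nbhs_nbhs.
  change (g @ x --> g x); rewrite -(fg _ Ax).
  apply: cvg_trans (h x Ax).
  by apply: near_eq_cvg; near=> z; apply: fg; near: z; exact: open_nbhs_nbhs.
have near_fg x : A x -> \forall y \near x, f y = g y.
  by move=> Ax; near=> z; apply: fg; near: z; exact: open_nbhs_nbhs.
move=> [h1 h2]; split=> [x Ax|v].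
  by apply: near_eq_differentiable (h1 x Ax); exact: near_fg.
apply: IH (h2 v) => x Ax; exact/near_eq_derive/near_fg.
Unshelve. all: by end_near. Qed.

Lemma Ck_cst V W k (A : set V) (c : W) : Ck k A (fun _ => c).
Proof.
elim: k c => [|k IH] c /=; first by move=> x _; exact: cst_continuous.
split=> [x _|v]; first exact: differentiable_cst.
have -> : (fun x => 'D_v (fun=> c) x) = (fun _ : V => 0 : W).
  by apply/funext => x; rewrite derive_cst.
exact: IH.
Qed.

Lemma Ck_lin V W k (A : set V) (f : V -> W) : linear f -> continuous f ->
  Ck k A f.
Proof.
move=> lf cf.
pose fM := GRing.isLinear.Build R V W _ f lf.
pose fL : {linear V -> W} := HB.pack f fM.
case: k => [|k] /=; first by move=> x _; exact: cf.
split=> [x _|v]; first exact: (@linear_differentiable _ _ _ fL).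
have -> : (fun x => 'D_v f x) = (fun _ : V => f v : W).
  apply/funext => x; rewrite deriveE ?(diff_lin (f:=fL))//.
  exact: (@linear_differentiable _ _ _ fL).
exact: Ck_cst.
Qed.

Lemma CkD V W k (A : set V) (f g : V -> W) : open A -> Ck k A f -> Ck k A g ->
  Ck k A (fun x => f x + g x).
Proof.
move=> oA; elim: k f g => [|k IH] f g /=.
  by move=> h1 h2 x Ax; apply: continuousD; [exact: h1|exact: h2].
move=> [f1 f2] [g1 g2]; split=> [x Ax|v].
  by apply: differentiableD; [exact: f1|exact: g1].
apply: (@Ck_eq _ _ _ _ (fun x => 'D_v f x + 'D_v g x)) => //.
  by move=> x Ax; rewrite deriveD//; apply: diff_derivable; [exact: f1|exact: g1].
exact: IH.
Qed.

Lemma CkZ V W k (A : set V) (f : V -> R^o) (g : V -> W) : open A ->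
  Ck k A f -> Ck k A g -> Ck k A (fun x => f x *: g x).
Proof.
move=> oA; elim: k f g => [|k IH] f g.
  by move=> h1 h2 x Ax; exact: (continuousZ (h1 x Ax) (h2 x Ax)).
move=> fk gk; have [f1 f2] := fk; have [g1 g2] := gk.
have dfg x : A x -> is_diff x (fun y => f y *: g y)
    (fun h => f x *: 'd g x h + 'd f x h *: g x).
  by move=> Ax; apply: is_diffZl; apply/differentiableP; [exact: f1|exact: g1].
split=> [x Ax|v]; first by case: (dfg x Ax).
apply: (@Ck_eq _ _ _ _ (fun x => f x *: 'D_v g x + 'D_v f x *: g x)) => //.
  move=> x Ax; have [d1 d2] := dfg x Ax.
  by rewrite (deriveE v d1) d2 (deriveE v (f1 x Ax)) (deriveE v (g1 x Ax)).
by apply: CkD => //; apply: IH; [exact: Ck_le|exact: g2|exact: f2|exact: Ck_le].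
Qed.

Lemma CkM V k (A : set V) (f g : V -> R^o) : open A ->
  Ck k A f -> Ck k A g -> Ck k A (fun x => f x * g x : R^o).
Proof. exact: CkZ. Qed.

Lemma Ck_sum V W k (A : set V) (I : Type) (r : seq I) (f : I -> V -> W) :
  open A -> (forall i, Ck k A (f i)) -> Ck k A (fun x => \sum_(i <- r) f i x).
Proof.
move=> oA fk; elim: r => [|i r IH].
  by under eq_fun do rewrite big_nil; exact: Ck_cst.
by under eq_fun do rewrite big_cons; exact: CkD.
Qed.

Lemma Ck_rV V m k (A : set V) (f : V -> 'rV[R]_m) :
  open A -> Ck k A f <-> (forall j, Ck k A (fun x => f x 0 j : R^o)).
Proof.
move=> oA; split.
  elim: k f => [|k IH] f.
    move=> h j x Ax; apply: (@continuous_comp _ _ _ f (fun y : 'rV[R]_m => y 0 j : R^o)).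
      exact: h.
    exact: coord_continuous.
  move=> [h1 h2] j; split=> [x Ax|v].
    apply: (@differentiable_comp _ _ _ _ f (fun y : 'rV[R]_m => y 0 j : R^o)).
      exact: h1.
    exact: differentiable_coord.
  apply: (@Ck_eq _ _ _ _ (fun x => ('D_v f x) 0 j : R^o)) => //.
    by move=> x Ax; rewrite derive_coord//; exact: h1.
  exact: (IH _ (h2 v)).
elim: k f => [|k IH] f.
  move=> h x Ax.
  have -> : f = \sum_(j < m) (fun y => f y 0 j *: delta_mx 0 j).
    by apply/funext => y; rewrite fct_sumE; exact: row_sum_delta.
  have := Ck_sum (index_enum 'I_m) oA (f := fun j y => f y 0 j *: (delta_mx 0 j : 'rV[R]_m)) (k:=0).
  have -> : (fun x => \sum_(i <- index_enum 'I_m) f x 0 i *: delta_mx 0 i) =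
     \sum_(j < m) (fun y => f y 0 j *: (delta_mx 0 j:'rV[R]_m)).
    by apply/funext => y; rewrite fct_sumE.
  apply => // i y Ay; apply: continuousZ; first exact: h.
  exact: cst_continuous.
move=> h; have df x : A x -> differentiable f x.
  by move=> Ax; apply: differentiable_coords => j; case: (h j) => + _; apply.
split=> // v; apply: IH => j.
apply: (@Ck_eq _ _ _ _ ('D_v (fun y => f y 0 j : R^o))) => //.
  by move=> x Ax; rewrite derive_coord//; exact: df.
by have [_ h2] := h j; exact: h2.
Qed.

Lemma Ck_lincomp U V W k (A : set U) (f : U -> V) (l : V -> W) :
  open A -> linear l -> continuous l -> Ck k A f -> Ck k A (fun x => l (f x)).
Proof.
move=> oA ll cl.
pose lM := GRing.isLinear.Build R V W _ l ll.
pose lL : {linear V -> W} := HB.pack l lM.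
have dl x : differentiable l x by exact: (@linear_differentiable _ _ _ lL).
elim: k f => [|k IH] f.
  move=> h x Ax; apply: (@continuous_comp _ _ _ f l); first exact: h.
  exact: cl.
move=> [h1 h2]; split=> [x Ax|v].
  by apply: (@differentiable_comp _ _ _ _ f l) => //; exact: h1.
apply: (@Ck_eq _ _ _ _ (fun x => l ('D_v f x))) => //.
  move=> x Ax; rewrite -[RHS]/('D_v (l \o f) x) (derive_comp v (h1 x Ax) (dl _)).
  by rewrite [RHS]deriveE// (diff_lin (f:=lL)).
exact: (IH _ (h2 v)).
Qed.

(** By the chain rule a derivative of g (f x) is the sum of the coordinates of
   the derivative of f times derivatives of g at f x, to which the induction
   hypothesis applies.  The intermediate space enters through a finite family of
   vectors and of continuous linear coordinates, so that row vectors and real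
   numbers are handled together. *)
Lemma Ck_comp U V W (I : finType) (e : I -> V) (c : I -> V -> R^o) k
    (A : set U) (B : set V) (f : U -> V) (g : V -> W) :
  (forall i, linear (c i)) -> (forall i, continuous (c i)) ->
  (forall v, v = \sum_i c i v *: e i) ->
  open A -> open B -> (forall x, A x -> B (f x)) ->
  Ck k A f -> Ck k B g -> Ck k A (fun x => g (f x)).
Proof.
move=> lc cc vE oA oB AB; elim: k f AB g => [|k IH] f AB g.
  move=> hf hg x Ax; apply: (@continuous_comp _ _ _ f g); first exact: hf.
  exact/hg/AB.
move=> fk gk; have [f1 f2] := fk; have [g1 g2] := gk.
split=> [x Ax|v].
  by apply: (@differentiable_comp _ _ _ _ f g); [exact: f1|exact/g1/AB].
apply: (@Ck_eq _ _ _ _ (fun x => \sum_i c i ('D_v f x) *: 'D_(e i) g (f x))) => //.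
  move=> x Ax; have dg := g1 _ (AB _ Ax).
  rewrite -[RHS]/('D_v (g \o f) x) (derive_comp v (f1 x Ax) dg).
  rewrite [in RHS](vE (derive f x v)) derive_sumv//.
  by apply: eq_bigr => i _; rewrite derive_scale.
apply: Ck_sum => // i; apply: CkZ => //.
  by apply: Ck_lincomp => //; exact: f2.
exact: (IH _ AB _ (Ck_le fk) (g2 (e i))).
Qed.

End CkTheory.

(** * Smoothness at a point *)

Section SmoothAt.
Context {R : realType}.
Implicit Types (U V W : normedModType R).

(** Smoothness in a neighbourhood, hence a condition that is stable under
   modification of f away from x. *)
Definition smooth_at V W (f : V -> W) (x : V) :=
  exists A : set V, [/\ open A, A x & smooth_on A f].

Lemma smooth_onP V W (A : set V) (f : V -> W) : open A ->
  smooth_on A f <-> forall x, A x -> smooth_at f x.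
Proof.
move=> oA; split=> [sf x Ax|sf k]; first by exists A.
apply/Ck_pt => x /sf [B [oB Bx /(_ k)]]; apply: Ck_sub => y ->.
exact: Bx.
Qed.

Lemma smooth_at_near V W (f : V -> W) x :
  smooth_at f x -> \forall y \near x, smooth_at f y.
Proof.
move=> [A [oA Ax sf]]; near=> y; exists A; split=> //.
by near: y; exact: open_nbhs_nbhs.
Unshelve. all: by end_near. Qed.

Lemma near_open V (P : V -> Prop) x : (\forall y \near x, P y) ->
  exists A : set V, [/\ open A, A x & A `<=` P].
Proof.
move=> xP; have : nbhs x P := xP.
by rewrite nbhsE => -[A [oA Ax] AP]; exists A.
Qed.

Lemma smooth_at_eq V W (f g : V -> W) x :
  (\forall y \near x, f y = g y) -> smooth_at f x -> smooth_at g x.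
Proof.
move=> /near_open[B [oB Bx fg]] [A [oA Ax sf]].
exists (A `&` B); split=> //; first exact: openI.
move=> k; apply: (@Ck_eq _ _ _ _ _ f); first exact: openI.
  by move=> y [_ /fg].
by apply: Ck_sub (sf k) => y [].
Qed.

Lemma smooth_at_diff V W (f : V -> W) x : smooth_at f x -> differentiable f x.
Proof. by move=> [A [oA Ax /(_ 1%N) [+ _]]]; exact. Qed.

Lemma smooth_at_cts V W (f : V -> W) x : smooth_at f x -> {for x, continuous f}.
Proof. by move=> /smooth_at_diff; exact: differentiable_continuous. Qed.

Lemma smooth_at_derive V W (f : V -> W) x v : smooth_at f x ->
  smooth_at ('D_v f) x.
Proof.
move=> [A [oA Ax sf]]; exists A; split=> // k.
by have [_ h2] := sf k.+1; exact: h2.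
Qed.

Lemma smooth_at_cst V W (c : W) (x : V) : smooth_at (fun=> c) x.
Proof. by exists setT; split=> //; [exact: openT|move=> k; exact: Ck_cst]. Qed.

Lemma smooth_at_lin V W (f : V -> W) x : linear f -> continuous f ->
  smooth_at f x.
Proof.
by exists setT; split=> //; [exact: openT|move=> k; exact: Ck_lin].
Qed.

Lemma smooth_at2 V W W' W'' (f : V -> W) (g : V -> W') (h : V -> W'') x :
  (forall A k, open A -> Ck k A f -> Ck k A g -> Ck k A h) ->
  smooth_at f x -> smooth_at g x -> smooth_at h x.
Proof.
move=> fgh [A [oA Ax sf]] [B [oB Bx sg]].
exists (A `&` B); split=> //; first exact: openI.
move=> k; apply: fgh; first exact: openI.
  by apply: Ck_sub (sf k) => y [].
by apply: Ck_sub (sg k) => y [].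
Qed.

Lemma smooth_atD V W (f g : V -> W) x : smooth_at f x -> smooth_at g x ->
  smooth_at (fun y => f y + g y) x.
Proof. by apply: smooth_at2 => A k; exact: CkD. Qed.

Lemma smooth_atZ V W (f : V -> R^o) (g : V -> W) x :
  smooth_at f x -> smooth_at g x -> smooth_at (fun y => f y *: g y) x.
Proof. by apply: smooth_at2 => A k; exact: CkZ. Qed.

Lemma smooth_atM V (f g : V -> R^o) x : smooth_at f x -> smooth_at g x ->
  smooth_at (fun y => f y * g y : R^o) x.
Proof. exact: smooth_atZ. Qed.

Lemma smooth_at_lincomp U V W (f : U -> V) (l : V -> W) x :
  linear l -> continuous l -> smooth_at f x -> smooth_at (fun y => l (f y)) x.
Proof.
move=> ll cl [A [oA Ax sf]]; exists A; split=> // k; exact: Ck_lincomp.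
Qed.

Lemma smooth_at_sum V W (I : Type) (r : seq I) (f : I -> V -> W) x :
  (forall i, smooth_at (f i) x) -> smooth_at (fun y => \sum_(i <- r) f i y) x.
Proof.
move=> sf; elim: r => [|i r IH].
  by under eq_fun do rewrite big_nil; exact: smooth_at_cst.
by under eq_fun do rewrite big_cons; exact: smooth_atD.
Qed.

Lemma smooth_at_prod V (I : Type) (r : seq I) (f : I -> V -> R^o) x :
  (forall i, smooth_at (f i) x) ->
  smooth_at (fun y => \prod_(i <- r) f i y : R^o) x.
Proof.
move=> sf; elim: r => [|i r IH].
  by under eq_fun do rewrite big_nil; exact: smooth_at_cst.
by under eq_fun do rewrite big_cons; exact: smooth_atM.
Qed.

Lemma smooth_at_rV V m (f : V -> 'rV[R]_m) x :
  smooth_at f x <-> forall j, smooth_at (fun y => f y 0 j : R^o) x.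
Proof.
split=> [[A [oA Ax sf]] j|sf].
  by exists A; split=> // k; move: j; apply/Ck_rV.
have : forall j, exists A : set V, [/\ open A, A x & smooth_on A (fun y => f y 0 j : R^o)].
  by move=> j; exact: (sf j).
move=> /choice[B hB].
have [A [oA Ax AB]] : exists A : set V, [/\ open A, A x &
    A `<=` [set y | forall j, B j y]].
  apply: near_open; apply: filter_forall => j.
  by have [oB Bx _] := hB j; exact: open_nbhs_nbhs.
exists A; split=> // k; apply/Ck_rV => // j.
by have [_ _ /(_ k)] := hB j; apply: Ck_sub => y /AB; exact.
Qed.

Lemma smooth_at_comp1 U V W (I : finType) (e : I -> V) (c : I -> V -> R^o)
    (f : U -> V) (g : V -> W) x :
  (forall i, linear (c i)) -> (forall i, continuous (c i)) ->
  (forall v, v = \sum_i c i v *: e i) ->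
  smooth_at f x -> smooth_at g (f x) -> smooth_at (fun y => g (f y)) x.
Proof.
move=> lc cc vE sf [B [oB Bfx sg]].
have [C [oC Cx CB]] : exists C : set U, [/\ open C, C x & C `<=` f @^-1` B].
  by apply: near_open; apply: (smooth_at_cts sf); exact: open_nbhs_nbhs.
have [A [oA Ax {}sf]] := sf.
exists (A `&` C); split=> //; first exact: openI.
move=> k; apply: (Ck_comp lc cc vE (openI oA oC) oB) (sg k).
  by move=> y [_ /CB].
by apply: Ck_sub (sf k) => y [].
Qed.

Lemma smooth_at_comp U W m (f : U -> 'rV[R]_m) (g : 'rV[R]_m -> W) x :
  smooth_at f x -> smooth_at g (f x) -> smooth_at (fun y => g (f y)) x.
Proof.
apply: (@smooth_at_comp1 _ _ _ _ (fun j => delta_mx 0 j)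
  (fun j (v : 'rV[R]_m) => v 0 j)).
- by move=> j a u v; rewrite !mxE.
- by move=> j; exact: coord_continuous.
- exact: row_sum_delta.
Qed.

Lemma smooth_at_compR U W (f : U -> R^o) (g : R^o -> W) x :
  smooth_at f x -> smooth_at g (f x) -> smooth_at (fun y => g (f y)) x.
Proof.
apply: (@smooth_at_comp1 U R^o W 'I_1 (fun=> 1) (fun _ v => v)).
- by [].
- by move=> j y; exact: cvg_id.
- by move=> v; rewrite big_ord1 -[RHS]/(v * 1) mulr1.
Qed.

End SmoothAt.

(** * Inverses, determinants and bump functions *)

Section RealFunctions.
Context {R : realType}.

Lemma derive_R (f : R^o -> R^o) (x v : R^o) : differentiable f x ->
  'D_v f x = v * 'D_1 f x.
Proof. by move=> df; rewrite -{1}[v]mulr1 -[v * 1]/(v *: 1) derive_scale. Qed.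

Lemma smooth_at_inv (x : R^o) : x != 0 -> smooth_at (fun y : R^o => y^-1 : R^o) x.
Proof.
move=> x0; pose A := [set y : R^o | y != 0].
have oA : open A by exact: (@open_neq R 0).
exists A; split=> //; elim=> [|k IH].
  by move=> y Ay; apply: inv_continuous.
have dinv y : A y -> differentiable (fun y : R^o => y^-1 : R^o) y.
  by move=> Ay; exact: differentiable_Rinv.
split=> // v.
apply: (@Ck_eq _ _ _ _ _ (fun y : R^o => - v * (y^-1 * y^-1) : R^o)) => //.
  move=> y Ay; rewrite derive_R; last exact: dinv.
  rewrite (@deriveV _ _ (fun y => y)) ?derive_id//=.
  by rewrite -[RHS]/(v * (_ * 1)) mulr1 expr2 invfM mulrN mulNr.
by apply: CkM => //; [exact: Ck_cst|exact: CkM].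
Qed.

Lemma smooth_atV (V : normedModType R) (f : V -> R^o) x : f x != 0 ->
  smooth_at f x -> smooth_at (fun y => (f y)^-1 : R^o) x.
Proof. by move=> fx0 sf; exact: (smooth_at_compR sf (smooth_at_inv fx0)). Qed.

Lemma smooth_at_det (V : normedModType R) m (f : V -> 'M[R]_m) x :
  (forall i j, smooth_at (fun y => f y i j : R^o) x) ->
  smooth_at (fun y => \det (f y) : R^o) x.
Proof.
move=> sf; apply: smooth_at_sum => s.
by apply: smooth_atM; [exact: smooth_at_cst|exact: smooth_at_prod].
Qed.

Lemma smooth_at_invmx (V : normedModType R) m (f : V -> 'M[R]_m) x :
  f x \in unitmx -> (forall i j, smooth_at (fun y => f y i j : R^o) x) ->
  forall i j, smooth_at (fun y => invmx (f y) i j : R^o) x.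
Proof.
move=> ux sf i j; have sd := smooth_at_det sf.
have dx : \det (f x) != 0 by rewrite -unitfE -unitmxE.
apply: (@smooth_at_eq _ _ _ (fun y => (\det (f y))^-1 *
  ((-1) ^+ (j + i) * \det (row' j (col' i (f y)))) : R^o)).
  have nd : \forall y \near x, \det (f y) != 0.
    exact: (@cvgr_neq0 _ R^o _ _ _ _ _ (smooth_at_cts sd)).
  near=> y.
  have dy : \det (f y) != 0 by near: y.
  by rewrite /invmx unitmxE unitfE dy !mxE.
apply: smooth_atM; first exact: smooth_atV.
apply: smooth_atM; first exact: smooth_at_cst.
apply: smooth_at_det => a b.
by under eq_fun do rewrite !mxE; exact: sf.
Unshelve. all: by end_near. Qed.

(** The derivatives of exp (- 1 / t) are combinations of these functions, and
   the derivative of each of them at 0 vanishes because the exponential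
   dominates every power. *)
Definition flat k (t : R) : R :=
  if 0 < t then expR (- t^-1) * (t^-1) ^+ k else 0.

Lemma flat_ge0 k t : 0 <= flat k t.
Proof.
rewrite /flat; case: ifP => // t0; rewrite mulr_ge0 ?expR_ge0// exprn_ge0//.
by rewrite invr_ge0 ltW.
Qed.

(** This is exp y >= y ^ (k + 1) / (k + 1)! at y = 1 / t. *)
Lemma flat_le k t : 0 <= t -> flat k t <= k.+1`!%:R * t.
Proof.
move=> t0; rewrite /flat; case: ifP => tp; last by rewrite mulr_ge0.
have ti : 0 < t^-1 by rewrite invr_gt0.
have := @expR_ge1Dxn R t^-1 k (ltW ti).
move=> /(le_trans _) -/(_ (t^-1 ^+ k.+1 / k.+1`!%:R)).
rewrite lerDr ler01 => /(_ isT) h.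
rewrite expRN mulrC ler_pdivrMr ?expR_gt0//.
apply: le_trans (_ : k.+1`!%:R * t * (t^-1 ^+ k.+1 / k.+1`!%:R) <= _); last first.
  by rewrite ler_wpM2l// mulr_ge0.
rewrite exprS.
have -> : k.+1`!%:R * t * (t^-1 * t^-1 ^+ k / k.+1`!%:R) =
  (t * t^-1) * (k.+1`!%:R / k.+1`!%:R) * t^-1 ^+ k by ring.
by rewrite mulfV ?gt_eqF// mulfV ?mul1r// pnatr_eq0 -lt0n fact_gt0.
Qed.

Lemma flat_derive k (t : R) :
  is_derive t (1 : R) (flat k) (flat k.+2 t - k%:R * flat k.+1 t).
Proof.
have [t0|t0|->] := ltgtP t 0.
- apply: (@near_eq_is_derive _ _ _ (cst 0)).
    near=> s; rewrite /flat ltNge ltW//=; near: s; exact: lt_nbhsl.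
  by rewrite /flat ltNge ltW//= mulr0 subrr; exact: is_derive_cst.
- apply: (@near_eq_is_derive _ _ _ (fun s : R => expR (- s^-1) * (s^-1) ^+ k)).
    near=> s; rewrite /flat ifT//; near: s; exact: lt_nbhsr.
  rewrite /flat t0.
  have dV : is_derive t 1 (fun s : R => s^-1) (- t ^- 2).
    apply: DeriveDef; first by apply: derivableV; rewrite ?gt_eqF.
    by rewrite deriveV ?gt_eqF//= derive_id -[LHS]/(_ * 1) mulr1.
  have dE : is_derive t 1 (fun s : R => expR (- s^-1)) (expR (- t^-1) * t ^- 2).
    have dN := is_deriveN dV.
    have := @is_derive1_comp R expR (fun s : R => - s^-1) t _ _ (is_derive_expR _) dN.
    by rewrite opprK.
  have dX := @is_deriveX _ _ _ k t 1 _ dV.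
  have -> : (fun s : R => expR (- s^-1) * s^-1 ^+ k) =
      (fun s : R => expR (- s^-1)) * (fun s : R => s^-1) ^+ k.
    by apply/funext => s; rewrite /= !fctE.
  apply: is_derive_eq (is_deriveM dE dX) _.
  have -> : ((fun s : R => s^-1) ^+ k) t = t^-1 ^+ k by rewrite fctE.
  case: k {dX} => [|k]; rewrite -![_ *: _]/(_ * _) -!exprVn.
    by rewrite !expr0; ring.
  by rewrite /= !exprS; ring.
have f0 : flat k 0 = 0 by rewrite /flat ltxx.
have cv : (fun h : R => h^-1 *: (flat k (h *: 1 + 0) - flat k 0)) @ 0^' --> (0 : R^o).
  apply/cvgr0Pnorm_le => e e0; near=> h.
  have h0 : h != 0 by near: h; exact: nbhs_dnbhs_neq.
  rewrite f0 subr0 addr0 -![_ *: _]/(_ * _) mulr1.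
  have [hn|hp|hh] := ltgtP h 0; last by rewrite hh eqxx in h0.
    by rewrite /flat ltNge (ltW hn)/= mulr0 normr0 ltW.
  have -> : h^-1 * flat k h = flat k.+1 h.
    by rewrite /flat hp exprS; ring.
  rewrite ger0_norm ?flat_ge0//; apply: le_trans (flat_le _ (ltW hp)) _.
  rewrite mulrC -ler_pdivlMr ?ltr0n ?fact_gt0//.
  rewrite -[h]gtr0_norm// ltW//; near: h; apply: dnbhs0_lt.
  by rewrite divr_gt0// ltr0n fact_gt0.
apply: DeriveDef; first by apply/cvg_ex; exists 0.
rewrite /derive (cvg_lim _ cv)//.
by rewrite /flat ltxx mulr0 subrr.
Unshelve. all: by end_near. Qed.

Lemma Ck_flat m k : Ck m setT (flat k : R^o -> R^o).
Proof.
elim: m k => [|m IH] k.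
  move=> t _; apply: differentiable_continuous; apply/derivable1_diffP.
  by have := flat_derive k t.
have df t : differentiable (flat k) t.
  by apply/derivable1_diffP; have := flat_derive k t.
split=> // v.
apply: (@Ck_eq _ _ _ _ _ (fun t => v * (flat k.+2 t + - k%:R * flat k.+1 t) : R^o)).
- exact: openT.
- move=> t _; rewrite derive_R//; have [_ ->] := flat_derive k t.
  by rewrite mulNr.
- apply: CkM; [exact: openT|exact: Ck_cst|].
  apply: CkD; [exact: openT|exact: IH|].
  by apply: CkM; [exact: openT|exact: Ck_cst|exact: IH].
Qed.

Lemma smooth_at_flat k t : smooth_at (flat k : R^o -> R^o) t.
Proof. by exists setT; split=> //; [exact: openT|move=> m; exact: Ck_flat]. Qed.

(** The witness is exp (- 1 / (r ^ 2 - |x - a| ^ 2)) for the Euclidean norm,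
   extended by 0; the ball of radius r for this norm is contained in the one for
   the sup norm, which defines the topology. *)
Lemma bump_exists m (a : 'rV[R]_m) (U : set 'rV[R]_m) : nbhs a U ->
  exists psi : 'rV[R]_m -> R^o, [/\ forall x, smooth_at psi x, psi a != 0 &
    exists K : set 'rV[R]_m, [/\ compact K, K `<=` U &
      forall x, ~ K x -> psi x = 0]].
Proof.
move=> /nbhs_ballP[e /= e0 eU].
pose q (x : 'rV[R]_m) : R := \sum_j (x 0 j - a 0 j) ^+ 2.
pose r := e / 2.
have r0 : 0 < r by rewrite divr_gt0.
have sq x : smooth_at (q : _ -> R^o) x.
  apply: smooth_at_sum => j; under eq_fun do rewrite expr2.
  have : smooth_at (fun y : 'rV[R]_m => y 0 j - a 0 j : R^o) x.
    apply: smooth_atD; last exact: smooth_at_cst.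
    apply: smooth_at_lin; last exact: coord_continuous.
    by move=> b u v; rewrite !mxE.
  by move=> sj; exact: smooth_atM.
have qle x j : q x <= r ^+ 2 -> `|x 0 j - a 0 j| <= r.
  move=> qx; rewrite -(@ler_pXn2r _ 2)// ?nnegrE ?normr_ge0 ?(ltW r0)//.
  apply: le_trans qx; rewrite real_normK ?num_real// /q (bigD1 j)//= lerDl.
  by apply: sumr_ge0 => k _; exact: sqr_ge0.
exists (fun x => flat 0 (r ^+ 2 - q x)); split.
- move=> x; apply: (@smooth_at_compR _ _ _ (fun x => r ^+ 2 - q x : R^o) (flat 0)).
    apply: smooth_atD; first exact: smooth_at_cst.
    apply: (@smooth_at_lincomp _ _ _ _ (q : _ -> R^o) (fun z : R^o => - z : R^o)) => //.
      by move=> b u v; rewrite opprD scalerN.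
    exact: opp_continuous.
  exact: smooth_at_flat.
- rewrite /q big1 ?subr0; last by move=> j _; rewrite subrr expr0n.
  by rewrite /flat exprn_gt0// expr0 mulr1 gt_eqF// expR_gt0.
- exists [set x | q x <= r ^+ 2]; split.
  + apply: bounded_closed_compact.
      exists (`|a| + r); split; first exact: num_real.
      move=> M ltM x /= qx; apply: le_trans (ltW ltM).
      rewrite -[x in leLHS](subrK a) addrC (le_trans (ler_normD _ _))// lerD2l.
      rewrite [leLHS]/Num.Def.normr/= mx_normrE; apply: bigmax_le; first exact: ltW.
      by move=> [i j] _; rewrite ord1 !mxE; exact: qle.
    have -> : [set x | q x <= r ^+ 2] = q @^-1` [set y | y <= r ^+ 2] by [].
    apply: preimage_closed; last exact: closed_le.
    by move=> x _; exact: (smooth_at_cts (sq x)).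
  + move=> x /= qx; apply: eU; rewrite -ball_normE /=.
    apply: (@le_lt_trans _ _ r); last by rewrite /r ltr_pdivrMr// ltr_pMr// ltr1n.
    rewrite -normrN opprB [leLHS]/Num.Def.normr/= mx_normrE; apply: bigmax_le; first exact: ltW.
    by move=> [i j] _; rewrite ord1 !mxE; exact: qle.
  + move=> x /= /negP; rewrite -ltNge => qx.
    by rewrite /flat ifF//; apply/negbTE; rewrite -leNgt subr_le0 ltW.
Qed.

End RealFunctions.

(** * Symmetry of second derivatives *)

Section Schwarz.
Context {R : realType} {V : normedModType R}.

Lemma is_derive_line (W : normedModType R) (f : V -> W) (a v : V) (s : R) :
  differentiable f (s *: v + a) ->
  is_derive s (1 : R^o) (fun t : R^o => f (t *: v + a)) ('D_v f (s *: v + a)).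
Proof.
move=> df.
have dl : is_diff (s : R^o) (fun t : R^o => t *: v + a) (fun t => t *: v).
  have dD := is_diffD (is_diff_scalel s v) (is_diff_cst a (s : R^o)).
  apply: is_diff_eq dD _; apply/funext => t; exact: addr0.
have dl1 : 'D_(1 : R^o) (fun t : R^o => t *: v + a) s = v.
  by case: dl => dl1 dl2; rewrite deriveE// dl2 scale1r.
have dc := @differentiable_comp _ _ _ _ _ f (s : R^o) (@ex_diff _ _ _ _ _ _ _ dl) df.
apply: DeriveDef; first exact: diff_derivable.
rewrite (@derive_comp _ _ _ _ (fun t : R^o => t *: v + a) f s (1 : R^o)) ?dl1//.
Qed.

(** The mean value theorem is applied along v to the increment of E in the
   direction w, and then along w to 'D_v E. *)
Lemma second_difference (E : V -> R^o) (y v w : V) (N : set V) :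
  smooth_at E y -> nbhs y N ->
  \forall h \near (0 : R)^'+, exists2 z, N z &
    E (h *: v + (h *: w + y)) - E (h *: v + y) - E (h *: w + y) + E y
    = h ^+ 2 * 'D_w ('D_v E) z.
Proof.
move=> sE Ny.
have : nbhs y (N `&` [set z | smooth_at E z]).
  by apply: filterI => //; exact: smooth_at_near.
move=> /nbhs_ballP[e /= e0 eN].
pose d := e / (`|v| + `|w| + 1).
have d0 : 0 < d by rewrite divr_gt0// addr_ge0_gt0// addr_ge0.
have inN s t h : s \in `[0, h] -> t \in `[0, h] -> h < d ->
    (N `&` [set z | smooth_at E z]) (t *: w + (s *: v + y)).
  rewrite !in_itv /= => /andP[s0 sh] /andP[t0 th] hd; apply: eN.
  rewrite -ball_normE /= -normrN opprB addrA addrK.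
  apply: le_lt_trans (ler_normD _ _) _; rewrite !normrZ !ger0_norm//.
  apply: (@le_lt_trans _ _ (h * (`|v| + `|w| + 1))).
    rewrite !mulrDr addrC -[X in X <= _]addr0 lerD//.
      by rewrite lerD// ler_wpM2r.
    by rewrite mulr1 (le_trans s0).
  by rewrite -ltr_pdivlMr// addr_ge0_gt0// addr_ge0.
near=> h.
have h0 : 0 < h by near: h; exact: nbhs_right_gt.
have hd : h < d by near: h; exact: nbhs_right_lt.
have hh : h \in `[0, h] by rewrite in_itv /= lexx ltW.
have h00 : 0 \in `[0, h] by rewrite in_itv /= lexx ltW.
have sE0 s : s \in `[0, h] -> smooth_at E (s *: v + y).
  by move=> sh; have [_ /=] := inN s 0 h sh h00 hd; rewrite scale0r add0r.
have sEh s : s \in `[0, h] -> smooth_at E (s *: v + (h *: w + y)).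
  by move=> sh; have [_ /=] := inN s h h sh hh hd; rewrite addrCA.
pose phi (s : R) : R := E (s *: v + (h *: w + y)) - E (s *: v + y).
pose dphi (s : R) : R := 'D_v E (s *: v + (h *: w + y)) - 'D_v E (s *: v + y).
have dphiE s : s \in `[0, h] -> is_derive s (1 : R) phi (dphi s).
  move=> sh; apply: is_deriveB; apply: is_derive_line; apply: smooth_at_diff.
    exact: sEh.
  exact: sE0.
have dphio s : s \in `]0, h[ -> is_derive s (1 : R) phi (dphi s).
  by move=> sh; apply: dphiE; exact: subset_itv_oo_cc.
have phic : {within `[0, h], continuous phi}.
  apply: derivable_within_continuous => s sh.
  by have [] := dphiE _ sh.
have [xi xih] := MVT_segment (ltW h0) dphio phic.
rewrite subr0 /phi /dphi !scale0r !add0r => Exi.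
pose psi (t : R) : R := 'D_v E (t *: w + (xi *: v + y)).
pose dpsi (t : R) : R := 'D_w ('D_v E) (t *: w + (xi *: v + y)).
have dpsiE t : t \in `[0, h] -> is_derive t (1 : R) psi (dpsi t).
  move=> th; apply: (@is_derive_line _ ('D_v E)).
  by apply: smooth_at_diff; apply: smooth_at_derive; have [] := inN _ _ _ xih th hd.
have dpsio s : s \in `]0, h[ -> is_derive s (1 : R) psi (dpsi s).
  by move=> sh; apply: dpsiE; exact: subset_itv_oo_cc.
have psic : {within `[0, h], continuous psi}.
  apply: derivable_within_continuous => s sh.
  by have [] := dpsiE _ sh.
have [eta etah] := MVT_segment (ltW h0) dpsio psic.
rewrite subr0 /psi /dpsi !scale0r !add0r => Eeta.
exists (eta *: w + (xi *: v + y)); first by have [] := inN _ _ _ xih etah hd.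
rewrite (addrCA (xi *: v)) Eeta in Exi.
transitivity ('D_w ('D_v E) (eta *: w + (xi *: v + y)) * h * h).
  by rewrite -Exi; ring.
by ring.
Unshelve. all: by end_near. Qed.

(** Both mixed derivatives are limits of the same second differences. *)
Lemma derive_symmetric (E : V -> R^o) (y v w : V) : smooth_at E y ->
  'D_v ('D_w E) y = 'D_w ('D_v E) y.
Proof.
move=> sE; apply/eqP; rewrite -subr_eq0 -normr_le0; apply/ler_addgt0Pl => e e0.
have e2 : 0 < e / 2 by rewrite divr_gt0.
have near2 v' w' : nbhs y [set z | `|'D_v' ('D_w' E) y - 'D_v' ('D_w' E) z| < e / 2].
  have /cvgrPdist_lt := smooth_at_cts (smooth_at_derive v' (smooth_at_derive w' sE)).
  exact.
have S1 := @second_difference E y w v _ sE (near2 v w).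
have S2 := @second_difference E y v w _ sE (near2 w v).
have [h [hp [[z1 z1n E1] [z2 z2n E2]]]] :=
  filter_ex (filterI (nbhs_right_gt (0 : R)) (filterI S1 S2)).
move: E1 E2 z1n z2n => /=; rewrite (addrCA (h *: w)).
move: ('D_v ('D_w E) z1) ('D_w ('D_v E) z2) => d1 d2.
move: ('D_v ('D_w E) y) ('D_w ('D_v E) y) => D1 D2.
move: (E (h *: v + (h *: w + y))) (E (h *: w + y)) (E (h *: v + y)) (E y).
move=> p q r s E1 E2 z1n z2n.
have d12 : d1 = d2.
  apply: (@mulfI _ (h ^+ 2)); first by rewrite expf_neq0// gt_eqF.
  by rewrite -E1 -E2; ring.
have -> : D1 - D2 = (D1 - d1) - (D2 - d2) by rewrite d12; ring.
rewrite addr0 (splitr e); apply: le_trans (ler_normB _ _) _.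
by apply: lerD; exact: ltW.
Qed.

End Schwarz.

(** * Derivatives of linear and affine maps *)

Section DeriveLinear.
Context {R : realType}.
Implicit Types (U V W : normedModType R).

(** The two difference quotients are the same function of h. *)
Lemma derive_affine U V W (F : V -> W) (iota : U -> V) (w : V) (y v : U) :
  (forall h : R, iota (h *: v + y) = h *: w + iota y) ->
  'D_v (fun b => F (iota b)) y = 'D_w F (iota y).
Proof.
move=> hi; rewrite /derive.
have -> : (fun h => h^-1 *: (((fun b => F (iota b)) \o shift y) (h *: v) - F (iota y))) =
  (fun h => h^-1 *: ((F \o shift (iota y)) (h *: w) - F (iota y))).
  by apply/funext => h /=; rewrite hi.
by [].
Qed.

Lemma derive_lin V W (f : V -> W) x v : linear f -> 'D_v f x = f v.
Proof.
move=> lf; have f0 : f 0 = 0.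
  by have := lf (-1) 0 0; rewrite scaleN1r addr0 oppr0 scaleN1r addNr.
rewrite /derive; apply: (lim_near_cst (@norm_hausdorff _ _)); near=> h.
have h0 : h != 0 by near: h; exact: nbhs_dnbhs_neq.
by rewrite /= lf addrK scalerA mulVf// scale1r.
Unshelve. all: by end_near. Qed.

Lemma derive_sum_delta W m (f : 'rV[R]_m -> W) x (v : 'rV[R]_m) :
  differentiable f x -> 'D_v f x = \sum_k v 0 k *: 'D_(delta_mx 0 k) f x.
Proof.
move=> df; rewrite {1}(row_sum_delta v) derive_sumv//.
by apply: eq_bigr => k _; rewrite derive_scale.
Qed.

Lemma lsubmx_cts n1 n2 : continuous (@lsubmx R 1 n1 n2).
Proof. by move=> x; apply: differentiable_continuous; exact: differentiable_lsubmx. Qed.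

Lemma rsubmx_cts n1 n2 : continuous (@rsubmx R 1 n1 n2).
Proof. by move=> x; apply: differentiable_continuous; exact: differentiable_rsubmx. Qed.

Lemma smooth_at_lsubmx n1 n2 x : smooth_at (@lsubmx R 1 n1 n2) x.
Proof. by apply: smooth_at_lin; [exact: linearP|exact: lsubmx_cts]. Qed.

Lemma smooth_at_rsubmx n1 n2 x : smooth_at (@rsubmx R 1 n1 n2) x.
Proof. by apply: smooth_at_lin; [exact: linearP|exact: rsubmx_cts]. Qed.

Lemma smooth_at_row_mx V n1 n2 (f : V -> 'rV[R]_n1) (g : V -> 'rV[R]_n2) x :
  smooth_at f x -> smooth_at g x -> smooth_at (fun y => row_mx (f y) (g y)) x.
Proof.
move=> /smooth_at_rV sf /smooth_at_rV sg; apply/smooth_at_rV => j.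
by case: (splitP j) => k jk;
  [have -> : j = lshift n2 k by exact: val_inj|
   have -> : j = rshift n1 k by exact: val_inj];
  under eq_fun do rewrite ?row_mxEl ?row_mxEr.
Qed.

(** The derivative is linear in b y, hence the sum of the coordinates of b y
   times partial derivatives of f at a y, each of which is smooth. *)
Lemma smooth_at_diff_map V W m (f : 'rV[R]_m -> W) (a b : V -> 'rV[R]_m) x :
  smooth_at f (a x) -> smooth_at a x -> smooth_at b x ->
  smooth_at (fun y => 'D_(b y) f (a y)) x.
Proof.
move=> sf sa sb.
apply: (@smooth_at_eq _ _ _ (fun y => \sum_k b y 0 k *: 'D_(delta_mx 0 k) f (a y))).
  have ca : \forall y \near x, smooth_at f (a y).
    exact: (smooth_at_cts sa) (smooth_at_near sf).
  near=> y; rewrite -derive_sum_delta//; apply: smooth_at_diff.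
  by near: y.
apply: smooth_at_sum => k; apply: smooth_atZ; first exact: (smooth_at_rV _ _).1.
exact: (smooth_at_comp sa (smooth_at_derive _ sf)).
Unshelve. all: by end_near. Qed.

End DeriveLinear.


(** * Atlases, independently of a topology *)

Section Atlas.
Context {R : realType}.

(** Stated in terms of the charts alone, so as to apply to a manifold and to its
   bundle of nonzero tangent vectors alike. *)
Record good_atlas (n : nat) (M : Type) (A : atlas R n M) : Prop := GoodAtlas {
  atlas_at : forall x, chart_dom (chart_at A x) x;
  atlas_inj : forall (i : chart_index A) x y, chart_dom i x -> chart_dom i y ->
    chart_map i x = chart_map i y -> x = y;
  atlas_open : forall i j : chart_index A,
    open (chart_map i @` (chart_dom i `&` chart_dom j));
  atlas_smooth : forall (i j : chart_index A) x, chart_dom i x ->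
    chart_dom j x -> smooth_at (local_rep i (chart_map j)) (chart_map i x)
}.

(** The neighbourhoods of p, read in a chart. *)
Definition mnear (n : nat) (M : Type) (A : atlas R n M) (p : M) (P : set M) :=
  let c := chart_at A p in
  \forall a \near chart_map c p,
    forall q, chart_dom c q -> chart_map c q = a -> P q.

(** The differential of F at p; [tcoord], [tmap] and [dfun] are the cases where F
   is a chart, a map read in a chart and a real function. *)
Definition mder (n : nat) (M : Type) (A : atlas R n M) (W : normedModType R)
    (F : M -> W) (p : M) (v : 'rV[R]_n) : W :=
  'D_v (local_rep (chart_at A p) F) (chart_map (chart_at A p) p).

Definition msmooth (n : nat) (M : Type) (A : atlas R n M) (W : normedModType R)
    (F : M -> W) (p : M) :=
  smooth_at (local_rep (chart_at A p) F) (chart_map (chart_at A p) p).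

Section OneAtlas.
Context (n : nat) (M : Type) (A : atlas R n M) (gA : good_atlas A).
Implicit Types (W : normedModType R) (i j : chart_index A) (p : M).

Lemma local_repE (V : zmodType) i (f : M -> V) p : chart_dom i p ->
  local_rep i f (chart_map i p) = f p.
Proof.
move=> ip; rewrite /local_rep; case: pselect => [h|[]]; last by exists p.
by case: cid => q [iq e] /=; congr f; exact: (atlas_inj gA) e.
Qed.

Lemma near_chart2 i j p (P : 'rV[R]_n -> Prop) : chart_dom i p ->
  chart_dom j p ->
  (forall q, chart_dom i q -> chart_dom j q -> P (chart_map i q)) ->
  \forall a \near chart_map i p, P a.
Proof.
move=> ip jp ijP.
have : nbhs (chart_map i p) (chart_map i @` (chart_dom i `&` chart_dom j)).
  by apply: open_nbhs_nbhs; split; [exact: atlas_open|exists p].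
by apply: filterS => _ [q [iq jq] <-]; exact: ijP.
Qed.

Lemma near_chart i p (P : 'rV[R]_n -> Prop) : chart_dom i p ->
  (forall q, chart_dom i q -> P (chart_map i q)) ->
  \forall a \near chart_map i p, P a.
Proof. by move=> ip iP; apply: (near_chart2 ip ip) => q iq _; exact: iP. Qed.

(** Transition maps are continuous and charts are injective. *)
Lemma mnear_move i j p (P : set M) : chart_dom i p -> chart_dom j p ->
  (\forall a \near chart_map i p,
    forall q, chart_dom i q -> chart_map i q = a -> P q) ->
  \forall a \near chart_map j p,
    forall q, chart_dom j q -> chart_map j q = a -> P q.
Proof.
move=> ip jp iP.
have ct : local_rep j (chart_map i) a @[a --> chart_map j p] --> chart_map i p.
  rewrite -(local_repE (chart_map i) jp).
  exact: smooth_at_cts (atlas_smooth gA jp ip).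
have nd : \forall a \near chart_map j p, exists q,
    [/\ chart_dom i q, chart_dom j q & chart_map j q = a].
  by apply: (near_chart2 jp ip) => q jq iq; exists q.
near=> a => q jq qa.
have [q' [iq' jq' q'a]] : exists q,
    [/\ chart_dom i q, chart_dom j q & chart_map j q = a] by near: a.
have <- : q' = q by apply: (atlas_inj gA) jq' jq _; rewrite q'a qa.
have : forall q0, chart_dom i q0 ->
    chart_map i q0 = local_rep j (chart_map i) a -> P q0.
  by near: a; exact: ct iP.
by apply => //; rewrite -q'a local_repE.
Unshelve. all: by end_near. Qed.

Lemma mnear_chart i p (P : set M) : chart_dom i p -> mnear A p P <->
  \forall a \near chart_map i p,
    forall q, chart_dom i q -> chart_map i q = a -> P q.
Proof.
have cp := atlas_at gA p.
by move=> ip; split; apply: mnear_move.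
Qed.

Lemma mnear_filter p : Filter (mnear A p).
Proof.
constructor; first by rewrite /mnear; near=> a.
- move=> P Q hP hQ; rewrite /mnear; near=> a => q cq qa; split.
    by move: q cq qa; near: a; exact: hP.
  by move: q cq qa; near: a; exact: hQ.
- move=> P Q PQ hP; rewrite /mnear; near=> a => q cq qa; apply: PQ.
  by move: q cq qa; near: a; exact: hP.
Unshelve. all: by end_near. Qed.

Lemma mnear_dom i p : chart_dom i p -> mnear A p (chart_dom i).
Proof. by move=> ip; apply/(mnear_chart _ ip); near=> a.
Unshelve. all: by end_near. Qed.

Lemma near_mnear i p (P : 'rV[R]_n -> Prop) : chart_dom i p ->
  (\forall a \near chart_map i p, P a) ->
  mnear A p (fun q => P (chart_map i q)).
Proof.
move=> ip iP; apply/(mnear_chart _ ip); near=> a => q iq ->.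
by near: a.
Unshelve. all: by end_near. Qed.

Lemma mnear_near i p (P : 'rV[R]_n -> Prop) (Q : M -> Prop) : chart_dom i p ->
  mnear A p Q -> (forall q, chart_dom i q -> Q q -> P (chart_map i q)) ->
  \forall a \near chart_map i p, P a.
Proof.
move=> ip /(mnear_chart _ ip) nQ QP.
have nd : \forall a \near chart_map i p, exists2 q, chart_dom i q & chart_map i q = a.
  by apply: (near_chart ip) => q iq; exists q.
near=> a.
have [q iq qa] : exists2 q, chart_dom i q & chart_map i q = a by near: a.
rewrite -qa; apply: QP => //; move: q iq qa; near: a; exact: nQ.
Unshelve. all: by end_near. Qed.

Lemma local_rep_near (V : zmodType) i p (F G : M -> V) : chart_dom i p ->
  mnear A p (fun q => F q = G q) ->
  \forall a \near chart_map i p, local_rep i F a = local_rep i G a.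
Proof.
move=> ip FG; apply: (mnear_near ip FG) => q iq.
by rewrite !local_repE.
Qed.

Lemma local_rep_transition (V : zmodType) i j p (F : M -> V) :
  chart_dom i p -> chart_dom j p -> \forall a \near chart_map i p,
    local_rep i F a = local_rep j F (local_rep i (chart_map j) a).
Proof.
move=> ip jp; apply: (near_chart2 ip jp) => q iq jq.
by rewrite !local_repE.
Qed.

Lemma msmooth_move W i j p (F : M -> W) : chart_dom i p -> chart_dom j p ->
  smooth_at (local_rep j F) (chart_map j p) ->
  smooth_at (local_rep i F) (chart_map i p).
Proof.
move=> ip jp sF.
apply: (smooth_at_eq (f := fun a => local_rep j F (local_rep i (chart_map j) a))).
  by have := local_rep_transition F ip jp; apply: filterS => a ->.
by apply: smooth_at_comp; [exact: atlas_smooth|rewrite local_repE].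
Qed.

Lemma msmooth_chart W i p (F : M -> W) : chart_dom i p ->
  msmooth A F p <-> smooth_at (local_rep i F) (chart_map i p).
Proof.
by move=> ip; have cp := atlas_at gA p; split; apply: msmooth_move.
Qed.

Lemma derive_move W i j p (F : M -> W) v : chart_dom i p -> chart_dom j p ->
  msmooth A F p ->
  'D_v (local_rep i F) (chart_map i p) =
  'D_('D_v (local_rep i (chart_map j)) (chart_map i p))
    (local_rep j F) (chart_map j p).
Proof.
move=> ip jp sF.
have st := smooth_at_diff (atlas_smooth gA ip jp).
have := smooth_at_diff ((msmooth_chart _ jp).1 sF).
rewrite -(local_repE (chart_map j) ip) => sj.
rewrite -(derive_comp v st sj).
by apply: near_eq_derive; exact: local_rep_transition.
Qed.

Lemma mder_chart W i p (F : M -> W) v : chart_dom i p -> msmooth A F p ->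
  mder A F p v = 'D_(tcoord i p v) (local_rep i F) (chart_map i p).
Proof. by move=> ip; apply: derive_move => //; exact: atlas_at. Qed.

Lemma mder_near W p (F G : M -> W) v : mnear A p (fun q => F q = G q) ->
  mder A F p v = mder A G p v.
Proof. by move=> FG; apply/near_eq_derive/local_rep_near => //; exact: atlas_at. Qed.

Lemma msmooth_near W p (F G : M -> W) : mnear A p (fun q => F q = G q) ->
  msmooth A F p -> msmooth A G p.
Proof. by move=> FG; apply/smooth_at_eq/local_rep_near => //; exact: atlas_at. Qed.

Lemma mder_linear W p (F : M -> W) : msmooth A F p -> linear (mder A F p).
Proof. by move=> /smooth_at_diff dF a v w; exact: derive_linear. Qed.

Lemma msmooth_coordinates i p : chart_dom i p -> msmooth A (chart_map i) p.
Proof. by move=> ip; apply: atlas_smooth => //; exact: atlas_at. Qed.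

Lemma tcoord_linear i p : chart_dom i p -> linear (@tcoord R n M A i p).
Proof. by move=> ip; apply: mder_linear; exact: msmooth_coordinates. Qed.

Lemma tcoord0 i p : tcoord i p 0 = 0.
Proof. exact: derive0. Qed.

Lemma tcoordZ i p a v : chart_dom i p -> tcoord i p (a *: v) = a *: tcoord i p v.
Proof.
by move=> ip; have := tcoord_linear ip a v 0; rewrite tcoord0 !addr0.
Qed.

(** The transition from a chart to itself is the identity near the point. *)
Lemma tcoord_self p v : tcoord (chart_at A p) p v = v.
Proof.
rewrite -[RHS](derive_id (chart_map (chart_at A p) p)); apply: near_eq_derive.
by apply: near_chart => [|q cq]; [exact: atlas_at|rewrite local_repE].
Qed.

Lemma tcoord_transition i j p v : chart_dom i p -> chart_dom j p ->
  tcoord j p v = 'D_(tcoord i p v) (local_rep i (chart_map j)) (chart_map i p).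
Proof. by move=> ip jp; apply: mder_chart => //; exact: msmooth_coordinates. Qed.

(** Inverse of [tcoord i p]: the differential of the transition back to the
   preferred chart at p. *)
Definition tvec i p (b : 'rV[R]_n) : 'rV[R]_n :=
  'D_b (local_rep i (chart_map (chart_at A p))) (chart_map i p).

Lemma tcoordK i p v : chart_dom i p -> tvec i p (tcoord i p v) = v.
Proof.
move=> ip; rewrite /tvec -(tcoord_transition v ip (atlas_at gA p)).
exact: tcoord_self.
Qed.

Lemma tvecK i p b : chart_dom i p -> tcoord i p (tvec i p b) = b.
Proof.
move=> ip; have cp := atlas_at gA p.
rewrite /tcoord /tvec -derive_move//; last exact: msmooth_coordinates.
rewrite -[RHS](derive_id (chart_map i p)); apply: near_eq_derive.
by apply: (near_chart ip) => q iq; rewrite local_repE.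
Qed.

Lemma smooth_funP (f : M -> R) :
  smooth_fun A f <-> forall p, msmooth A (f : M -> R^o) p.
Proof.
have oi i : open (chart_map i @` chart_dom i).
  by rewrite -(setIid (chart_dom i)); exact: atlas_open.
split=> [sf p|sf i].
  have /(smooth_onP _ (oi _)) := sf (chart_at A p).
  by apply; exists p => //; exact: atlas_at.
apply/(smooth_onP _ (oi _)) => _ [p ip <-].
by apply/msmooth_chart.
Qed.

Lemma msmooth_cst W (c : W) p : msmooth A (fun=> c) p.
Proof.
apply: (smooth_at_eq (f := fun=> c)); last exact: smooth_at_cst.
by apply: near_chart => [|q cq]; [exact: atlas_at|rewrite local_repE].
Qed.

Lemma msmoothD W (F G : M -> W) p : msmooth A F p -> msmooth A G p ->
  msmooth A (fun q => F q + G q) p.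
Proof.
move=> sF sG; apply: smooth_at_eq (smooth_atD sF sG).
by apply: near_chart => [|q cq]; [exact: atlas_at|rewrite !local_repE].
Qed.

Lemma msmoothZ W (F : M -> R^o) (G : M -> W) p : msmooth A F p -> msmooth A G p ->
  msmooth A (fun q => F q *: G q) p.
Proof.
move=> sF sG; apply: smooth_at_eq (smooth_atZ sF sG).
by apply: near_chart => [|q cq]; [exact: atlas_at|rewrite !local_repE].
Qed.

Lemma msmooth_sum W (I : finType) (F : I -> M -> W) p :
  (forall k, msmooth A (F k) p) -> msmooth A (fun q => \sum_k F k q) p.
Proof.
move=> sF; elim: (index_enum I) => [|k r IH].
  by under eq_fun do rewrite big_nil; exact: msmooth_cst.
by under eq_fun do rewrite big_cons; exact: msmoothD.
Qed.

Lemma msmooth_comp W m (F : M -> 'rV[R]_m) (G : 'rV[R]_m -> W) p :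
  msmooth A F p -> smooth_at G (F p) -> msmooth A (fun q => G (F q)) p.
Proof.
move=> sF; rewrite -(local_repE F (atlas_at gA p)) => sG.
apply: smooth_at_eq (smooth_at_comp sF sG).
by apply: near_chart => [|q cq]; [exact: atlas_at|rewrite !local_repE].
Qed.

Lemma mder_lincomp W W' (F : M -> W) (l : W -> W') p v :
  linear l -> continuous l -> msmooth A F p ->
  mder A (fun q => l (F q)) p v = l (mder A F p v).
Proof.
move=> ll cl sF.
have dl : differentiable l (local_rep (chart_at A p) F (chart_map (chart_at A p) p)).
  exact: smooth_at_diff (smooth_at_lin _ ll cl).
have := derive_comp v (smooth_at_diff sF) dl.
rewrite (derive_lin _ _ ll) => e; apply: etrans e; apply: near_eq_derive.
by apply: near_chart => [|q cq]; [exact: atlas_at|rewrite /= !local_repE].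
Qed.

Lemma msmooth_row_mx n1 n2 (F : M -> 'rV[R]_n1) (G : M -> 'rV[R]_n2) p :
  msmooth A F p -> msmooth A G p -> msmooth A (fun q => row_mx (F q) (G q)) p.
Proof.
move=> sF sG; apply: smooth_at_eq (smooth_at_row_mx sF sG).
by apply: near_chart => [|q cq]; [exact: atlas_at|rewrite !local_repE].
Qed.

Lemma msmooth_rV m (F : M -> 'rV[R]_m) p :
  msmooth A F p <-> forall k, msmooth A (fun q => F q 0 k : R^o) p.
Proof.
have E k : \forall a \near chart_map (chart_at A p) p,
    local_rep (chart_at A p) F a 0 k =
    local_rep (chart_at A p) (fun q => F q 0 k : R^o) a.
  by apply: near_chart => [|q cq]; [exact: atlas_at|rewrite !local_repE].
split=> [/smooth_at_rV sF k|sF].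
  exact: smooth_at_eq (E k) (sF k).
apply/smooth_at_rV => k; apply: smooth_at_eq (sF k).
by apply: filterS (E k) => a ->.
Qed.

(** In a chart this is Cramer's rule: entries of the inverse are quotients of
   determinants. *)
Lemma msmooth_invmx m (F : M -> 'M[R]_m) p : F p \in unitmx ->
  (forall k l, msmooth A (fun q => F q k l : R^o) p) ->
  forall k l, msmooth A (fun q => invmx (F q) k l : R^o) p.
Proof.
move=> ux sF k l; have cp := atlas_at gA p.
pose G a : 'M[R]_m := \matrix_(k, l) local_rep (chart_at A p) (fun q => F q k l : R^o) a.
have GF q : chart_dom (chart_at A p) q -> G (chart_map (chart_at A p) q) = F q.
  by move=> cq; apply/matrixP => a b; rewrite mxE local_repE.
have uG : G (chart_map (chart_at A p) p) \in unitmx by rewrite GF.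
have sG a b : smooth_at (fun y => G y a b : R^o) (chart_map (chart_at A p) p).
  by apply: smooth_at_eq (sF a b); near=> y; rewrite mxE.
apply: smooth_at_eq (smooth_at_invmx uG sG k l).
by apply: (near_chart cp) => q cq; rewrite local_repE// GF.
Unshelve. all: by end_near. Qed.

End OneAtlas.
End Atlas.

(** * Smooth maps and sections along them *)

Section Maps.
Context {R : realType} (m n : nat) (N M : Type) (B : atlas R m N)
  (A : atlas R n M) (gB : good_atlas B) (gA : good_atlas A).

Definition smooth_map (f : N -> M) := forall p (j : chart_index A),
  chart_dom j (f p) ->
  mnear B p (f @^-1` chart_dom j) /\ msmooth B (fun q => chart_map j (f q)) p.

Context (f : N -> M) (sf : smooth_map f).

Lemma local_rep_map (W : normedModType R) (F : M -> W) p (j : chart_index A) :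
  chart_dom j (f p) ->
  \forall a \near chart_map (chart_at B p) p,
    local_rep (chart_at B p) (fun q => F (f q)) a =
    local_rep j F (local_rep (chart_at B p) (fun q => chart_map j (f q)) a).
Proof.
move=> jp; have [nf _] := sf jp.
apply: (mnear_near gB (atlas_at gB p) nf) => q cq jq.
by rewrite !(local_repE gB)// (local_repE gA).
Qed.

Lemma mnear_map p (P : set M) : mnear A (f p) P ->
  mnear B p (fun q => P (f q)).
Proof.
move=> hP; have [nf smf] := sf (atlas_at gA (f p)).
have cp := atlas_at gB p.
have ct := smooth_at_cts smf.
have ce := local_repE gB (fun q => chart_map (chart_at A (f p)) (f q)) cp.
have {}ct : local_rep (chart_at B p) (fun q => chart_map (chart_at A (f p)) (f q)) a
    @[a --> chart_map (chart_at B p) p] --> chart_map (chart_at A (f p)) (f p).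
  by rewrite -[X in _ --> X]ce; exact: ct.
have FB := @mnear_filter _ _ _ B p.
have nP := near_mnear gB cp (ct _ hP).
apply: filterS3 (mnear_dom gB cp) nf nP => q cq fq.
by rewrite /= (local_repE gB)//; apply.
Qed.

Lemma msmooth_map (W : normedModType R) (F : M -> W) p :
  msmooth A F (f p) -> msmooth B (fun q => F (f q)) p.
Proof.
move=> sF; have [_ smf] := sf (atlas_at gA (f p)).
apply: (@smooth_at_eq _ _ _ (fun a => local_rep (chart_at A (f p)) F
    (local_rep (chart_at B p) (fun q => chart_map (chart_at A (f p)) (f q)) a))).
  have h := local_rep_map F (atlas_at gA (f p)).
  apply: filterS h => a.
  exact: esym.
apply: smooth_at_comp; first exact: smf.
by rewrite (local_repE gB); [|exact: atlas_at].
Qed.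

Lemma mder_map (W : normedModType R) (F : M -> W) p v : msmooth A F (f p) ->
  mder B (fun q => F (f q)) p v = mder A F (f p) (tmap B A f p v).
Proof.
move=> sF; have [_ smf] := sf (atlas_at gA (f p)).
have dg := smooth_at_diff smf.
have := smooth_at_diff sF.
have ce := local_repE gB (fun q => chart_map (chart_at A (f p)) (f q)) (atlas_at gB p).
rewrite -ce => dF; have := derive_comp v dg dF; rewrite ce => e.
apply: etrans e; apply: near_eq_derive.
exact: local_rep_map (atlas_at gA (f p)).
Qed.

Lemma smooth_sectionP (s : N -> 'rV[R]_n) : smooth_section B A f s <->
  forall p (j : chart_index A), chart_dom j (f p) ->
    msmooth B (fun q => tcoord j (f q) (s q)) p.
Proof.
have oi (i : chart_index B) (j : chart_index A) :
    open (chart_map i @` (chart_dom i `&` f @^-1` chart_dom j)).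
  rewrite openE => _ [p [ip jp] <-]; rewrite /interior.
  apply: (mnear_near gB ip (proj1 (sf jp))) => q iq jq.
  by exists q.
split=> [ss p j jp|ss i j].
  have /(smooth_onP _ (oi _ _)) := ss (chart_at B p) j.
  by apply; exists p => //; split=> //; exact: atlas_at.
apply/(smooth_onP _ (oi _ _)) => _ [p [ip jp] <-].
by apply/(msmooth_chart gB) => //; exact: ss.
Qed.

(** A change of chart of the target applies to the components the differential
   of a transition map, at a point that varies smoothly. *)
Lemma smooth_section_local (s : N -> 'rV[R]_n) :
  (forall p, exists2 j : chart_index A, chart_dom j (f p) &
    msmooth B (fun q => tcoord j (f q) (s q)) p) ->
  smooth_section B A f s.
Proof.
move=> ss; apply/smooth_sectionP => p j jp.
have [i ip si] := ss p.
have [ni smi] := sf ip; have [nj _] := sf jp.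
apply: (@msmooth_near _ _ _ _ gB _ _ (fun q =>
    'D_(tcoord i (f q) (s q)) (local_rep i (chart_map j)) (chart_map i (f q)))).
  have FB := @mnear_filter _ _ _ B p.
  apply: filterS2 ni nj => q iq jq.
  by rewrite -(tcoord_transition gA).
have cp := atlas_at gB p.
apply: (@smooth_at_eq _ _ _ (fun a =>
   'D_(local_rep (chart_at B p) (fun q => tcoord i (f q) (s q)) a)
     (local_rep i (chart_map j))
     (local_rep (chart_at B p) (fun q => chart_map i (f q)) a))).
  by apply: (near_chart gB cp) => q cq; rewrite !(local_repE gB).
apply: smooth_at_diff_map => //.
by rewrite (local_repE gB)//; exact: atlas_smooth.
Qed.

Lemma smooth_sectionZ (h : N -> R) (s : N -> 'rV[R]_n) : smooth_fun B h ->
  smooth_section B A f s -> smooth_section B A f (fun q => h q *: s q).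
Proof.
move=> /(smooth_funP gB) sh /smooth_sectionP ss.
apply/smooth_sectionP => p j jp; have [nj _] := sf jp.
apply: (@msmooth_near _ _ _ _ gB _ _ (fun q => h q *: tcoord j (f q) (s q))).
  have FB := @mnear_filter _ _ _ B p.
  by apply: filterS nj => q jq; rewrite (tcoordZ gA).
by apply: (msmoothZ gB); [exact: sh|exact: ss].
Qed.

Lemma smooth_fun_cst (c : R) : smooth_fun B (fun=> c).
Proof. by apply/(smooth_funP gB) => p; exact: msmooth_cst. Qed.

Lemma smooth_sectionN (s : N -> 'rV[R]_n) :
  smooth_section B A f s -> smooth_section B A f (fun q => - s q).
Proof.
move=> ss; have := smooth_sectionZ (smooth_fun_cst (-1)) ss.
by under eq_fun do rewrite scaleN1r.
Qed.

Lemma smooth_section_cst0 : smooth_section B A f (fun=> 0).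
Proof.
apply: smooth_section_local => p; exists (chart_at A (f p)); first exact: atlas_at.
by under eq_fun do rewrite tcoord0; exact: msmooth_cst.
Qed.

End Maps.

Section IdMap.
Context {R : realType} (n : nat) (M : Type) (A : atlas R n M)
  (gA : good_atlas A).

Lemma smooth_map_id : smooth_map A A id.
Proof.
by move=> p j jp; split; [exact: mnear_dom|exact: msmooth_coordinates].
Qed.

Lemma tmap_id p v : tmap A A id p v = v.
Proof. exact: tcoord_self. Qed.

End IdMap.

(** * Bump functions on a manifold *)

Section Manifold.
Context {R : realType} (n : nat) (M : topologicalType) (A : atlas R n M)
  (mA : smooth_manifold A).

Lemma manifold_good : good_atlas A.
Proof.
case: mA => _ _ [h1 h2 h3 [h4 h5] h6].
have oi (i j : chart_index A) :
    open (chart_map i @` (chart_dom i `&` chart_dom j)).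
  by apply: h5; [exact: openI|exact: subIsetl].
split=> // i j x ix jx.
by have /(smooth_onP _ (oi _ _)) := h6 i j; apply; exists x.
Qed.

Let gA := manifold_good.

Lemma nbhs_mnear (x : M) (P : set M) : nbhs x P -> mnear A x P.
Proof.
rewrite nbhsE => -[U [oU Ux] UP].
case: mA => _ _ [h1 h2 h3 [h4 h5] h6].
have cx := h1 x.
have : nbhs (chart_map (chart_at A x) x)
    (chart_map (chart_at A x) @` (U `&` chart_dom (chart_at A x))).
  apply: open_nbhs_nbhs; split; last by exists x.
  by apply: h5; [exact: openI|exact: subIsetr].
rewrite /mnear; apply: filterS => _ [q [Uq cq] <-] q' cq' /h3 => /(_ cq' cq) ->.
exact: UP.
Qed.

(** The support of a bump function is the homeomorphic image of a compact set,
   hence closed in the Hausdorff space M: outside of it extension by 0 is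
   smooth. *)
Lemma bump_function (x : M) : exists phi : M -> R,
  [/\ smooth_fun A phi, phi x != 0 &
    forall p, mnear A p (fun q => phi q = 0) \/ chart_dom (chart_at A x) p].
Proof.
case: mA => hM _ [h1 h2 h3 [h4 h5] h6].
set c := chart_at A x; have cx : chart_dom c x by exact: h1.
pose U := chart_map c @` chart_dom c.
have oU : open U by apply: h5.
have Ux : nbhs (chart_map c x) U by apply: open_nbhs_nbhs; split => //; exists x.
have [psi [spsi psix [K [cK KU psiK]]]] := bump_exists Ux.
pose inv (a : 'rV[R]_n) : M := if pselect (exists2 p, chart_dom c p & chart_map c p = a) is left h
  then projT1 (cid2 h) else x.
have invE p : chart_dom c p -> inv (chart_map c p) = p.
  move=> cp; rewrite /inv; case: pselect => [h|[]]; last by exists p.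
  by case: cid2 => q /= cq e; exact: h3 e.
pose C := inv @` K.
have CE p : C p <-> chart_dom c p /\ K (chart_map c p).
  split=> [[a Ka <-]|[cp Kp]]; last by exists (chart_map c p) => //; exact: invE.
  by have [q cq qa] := KU _ Ka; move: Ka; rewrite -qa invE.
have clC : closed C.
  apply: (compact_closed hM); apply: continuous_compact cK.
  apply: continuous_in_subspaceT => a; rewrite inE => /KU [p cp <-] V.
  rewrite invE// nbhsE => -[V' [oV' V'p] V'V].
  have : nbhs (chart_map c p) (chart_map c @` (V' `&` chart_dom c)).
    apply: open_nbhs_nbhs; split; last by exists p.
    by apply: h5; [exact: openI|exact: subIsetr].
  by apply: filterS => _ [q [V'q cq] <-]; rewrite /= invE//; exact: V'V.
pose phi p : R := if pselect (chart_dom c p) is left _ then psi (chart_map c p) else 0.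
have phic p : chart_dom c p -> phi p = psi (chart_map c p).
  by rewrite /phi; case: pselect.
have phi0 p : ~ C p -> phi p = 0.
  rewrite /phi; case: pselect => // cp nC; apply: psiK => Kp; apply: nC.
  exact/CE.
have FB p := @mnear_filter _ _ _ A p.
have dich p : mnear A p (fun q => phi q = 0) \/ chart_dom c p.
  have [cp|ncp] := pselect (chart_dom c p); [by right|left].
  have : mnear A p (~` C).
    apply: nbhs_mnear; apply: open_nbhs_nbhs; split; first exact: closed_openC.
    by move=> /CE[].
  by apply: filterS => q /phi0.
exists phi; split=> //; last by rewrite phic.
apply/(smooth_funP gA) => p; case: (dich p) => [p0|cp].
  apply: (@msmooth_near _ _ _ _ gA _ _ (fun=> 0)); last exact: msmooth_cst.
  by apply: filterS p0 => q.
apply: (@msmooth_near _ _ _ _ gA _ _ (fun q => psi (chart_map c q))).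
  by apply: filterS (mnear_dom gA cp) => q /phic.
by apply: msmooth_comp => //; exact: msmooth_coordinates.
Qed.

End Manifold.

(** * The bundle of nonzero tangent vectors *)

Section Slit.
Context {R : realType} (n : nat) (M : Type) (A : atlas R n M)
  (gA : good_atlas A).

Local Notation SA := (slit_atlas A).
Local Notation pr := (@slit_proj R n M).

Definition mkslit (x : M) (y : 'rV[R]_n) (y0 : y != 0) : slit R n M :=
  exist _ (x, y) y0.

Lemma eta_neq0 (u : slit R n M) : eta u != 0.
Proof. exact: valP u. Qed.

Lemma slit_eq (u v : slit R n M) : pr u = pr v -> eta u = eta v -> u = v.
Proof.
move=> e1 e2; apply/val_inj; move: e1 e2; rewrite /slit_proj /eta.
by case: (val u) (val v) => [a b] [c d] /= -> ->.
Qed.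

Lemma tcoord_neq0 (i : chart_index A) x y : chart_dom i x ->
  (tcoord i x y != 0) = (y != 0).
Proof.
move=> ix; congr (~~ _); apply/eqP/eqP => [e|->]; last exact: tcoord0.
by rewrite -(tcoordK gA y ix) e /tvec derive0.
Qed.

(** The image of an intersection of chart domains is its image in M times the
   complement of the origin, and the transition maps are
   (a, b) |-> (tau a, d tau_a b). *)
Lemma slit_good : good_atlas SA.
Proof.
have img (i j : chart_index A) :
    (chart_map (a := SA) i) @` (chart_dom (a := SA) i `&` chart_dom (a := SA) j) =
    [set c | (chart_map i @` (chart_dom i `&` chart_dom j)) (lsubmx c) /\
       rsubmx c != 0].
  apply/seteqP; split=> [_ [u [iu ju] <-] /=|c /= [[x [ix jx] xc] c0]].
    rewrite /tangent_chart row_mxKl row_mxKr tcoord_neq0//; split.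
      by exists (pr u).
    exact: eta_neq0.
  have y0 : tvec i x (rsubmx c) != 0.
    by rewrite -(@tcoord_neq0 i x)// tvecK.
  exists (mkslit x y0); first by [].
  by rewrite /= /tangent_chart /= tvecK// xc hsubmxK.
have oi (i j : chart_index A) : open ((chart_map (a := SA) i) @`
    (chart_dom (a := SA) i `&` chart_dom (a := SA) j)).
  have o1 : open (@lsubmx R 1 n n @^-1`
      (chart_map i @` (chart_dom i `&` chart_dom j))).
    by apply: open_comp; [move=> x _; exact: lsubmx_cts|exact: atlas_open].
  have o2 : open (@rsubmx R 1 n n @^-1` [set y | y != 0]).
    apply: open_comp; first by move=> x _; exact: rsubmx_cts.
    have -> : [set y : 'rV[R]_n | y != 0] = ~` [set 0].
      by apply/seteqP; split=> y /= /eqP.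
    apply: closed_openC; apply: accessible_closed_set1.
    by apply: hausdorff_accessible; exact: norm_hausdorff.
  by rewrite img; exact: openI o1 o2.
have inj (i : chart_index A) (u v : slit R n M) : chart_dom i (pr u) ->
    chart_dom i (pr v) -> tangent_chart i (val u) = tangent_chart i (val v) ->
    u = v.
  move=> iu iv /eq_row_mx[e1 e2].
  have e : pr u = pr v by exact: (atlas_inj gA) iu iv e1.
  apply: slit_eq => //.
  rewrite -(tcoordK gA (eta u) iu) -(tcoordK gA (eta v) iv).
  by rewrite [X in tvec i _ X]e2 e.
suff sm (i j : chart_index A) (u : slit R n M) : chart_dom i (pr u) ->
    chart_dom j (pr u) -> smooth_at
      (local_rep (A := SA) i (chart_map (a := SA) j)) (chart_map (a := SA) i u).
  by apply: (@GoodAtlas _ _ _ SA) inj oi sm => u; exact: (atlas_at gA (pr u)).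
move=> iu ju.
apply: (@smooth_at_eq _ _ _ (fun c => row_mx (local_rep i (chart_map j) (lsubmx c))
   ('D_(rsubmx c) (local_rep i (chart_map j)) (lsubmx c)))).
  have : nbhs (chart_map (a := SA) i u) ((chart_map (a := SA) i) @`
    (chart_dom (a := SA) i `&` chart_dom (a := SA) j)).
    by apply: open_nbhs_nbhs; split; [exact: oi|exists u].
  apply: filterS => _ [v [iv jv] <-].
  have -> : local_rep (A := SA) i (chart_map (a := SA) j) (chart_map (a := SA) i v) =
      chart_map (a := SA) j v.
    rewrite /local_rep; case: pselect => [h|[]]; last by exists v.
    by case: cid => q [iq e] /=; congr (tangent_chart _ (val _)); exact: inj e.
  have el : lsubmx (tangent_chart i (val v)) = chart_map i (pr v).
    exact: row_mxKl.
  have er : rsubmx (tangent_chart i (val v)) = tcoord i (pr v) (eta v).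
    exact: row_mxKr.
  rewrite el er (local_repE gA (chart_map j) iv).
  by rewrite -(tcoord_transition gA (eta v) iv jv).
have st : smooth_at (local_rep i (chart_map j)) (lsubmx (chart_map (a := SA) i u)).
  by rewrite /= /tangent_chart row_mxKl; exact: atlas_smooth.
apply: smooth_at_row_mx.
  by apply: smooth_at_comp; [exact: smooth_at_lsubmx|].
by apply: smooth_at_diff_map => //; [exact: smooth_at_lsubmx|exact: smooth_at_rsubmx].
Qed.

Let gS := slit_good.

Lemma smooth_map_proj : smooth_map SA A pr.
Proof.
move=> u j ju; split; first exact: (@mnear_dom _ _ _ SA gS j u ju).
apply/(@msmooth_chart _ _ _ SA gS _ j u _ ju).
apply: smooth_at_eq (@smooth_at_lsubmx _ _ _ _).
apply: (@near_chart _ _ _ SA gS j u _ ju) => q jq.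
by rewrite (@local_repE _ _ _ SA gS _ j _ q jq) /= /tangent_chart row_mxKl.
Qed.

Lemma msmooth_fibre_coordinates (j : chart_index A) u : chart_dom j (pr u) ->
  msmooth SA (fun q => tcoord j (pr q) (eta q)) u.
Proof.
move=> ju; apply/(@msmooth_chart _ _ _ SA gS _ j u _ ju).
apply: smooth_at_eq (@smooth_at_rsubmx _ _ _ _).
apply: (@near_chart _ _ _ SA gS j u _ ju) => q jq.
by rewrite (@local_repE _ _ _ SA gS _ j _ q jq) /= /tangent_chart row_mxKr.
Qed.

Lemma smooth_eta : smooth_pi_vfield A (@eta R n M).
Proof.
have [_ h] := smooth_sectionP gS smooth_map_proj (@eta R n M); apply: h => u j.
exact: msmooth_fibre_coordinates.
Qed.

Lemma rhoE u w : rho A u w = lsubmx w.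
Proof.
have cu : chart_dom (a := SA) (chart_at SA u) u by exact: atlas_at.
rewrite -[RHS](@derive_lin _ _ _ (@lsubmx R 1 n n) (chart_map (chart_at SA u) u)); last first.
  exact: linearP.
apply: near_eq_derive; apply: (@near_chart _ _ _ SA gS _ u _ cu) => q jq.
by rewrite (@local_repE _ _ _ SA gS _ _ _ q jq) /= /tangent_chart row_mxKl.
Qed.

Lemma gammaE u v : gamma A u v = row_mx 0 v.
Proof.
rewrite /gamma /tangent_chart /=.
rewrite (_ : (fun y => _) = fun y => row_mx (chart_map (chart_at A (pr u)) (pr u)) y); last first.
  by apply/funext => y; rewrite tcoord_self.
pose a : 'rV[R]_n := chart_map (chart_at A (pr u)) (pr u).
rewrite (@derive_affine _ _ _ _ id (fun y => row_mx a y) (row_mx 0 v)) ?derive_id//.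
by move=> h; rewrite scale_row_mx add_row_mx scaler0 add0r.
Qed.

(** The projection to M reads (a, b) |-> a in induced charts. *)
Lemma lsubmx_tcoord (j : chart_index A) u w : chart_dom j (pr u) ->
  lsubmx (tcoord (A := SA) j u w) = tcoord j (pr u) (lsubmx w).
Proof.
move=> ju.
have sj := @msmooth_coordinates _ _ _ SA gS j u ju.
have e1 : lsubmx (tcoord (A := SA) j u w) =
    mder SA (fun q => lsubmx (chart_map (a := SA) j q)) u w.
  symmetry; apply: (mder_lincomp gS _ _ _ sj); first exact: linearP.
  exact: lsubmx_cts.
have e2 : (fun q => lsubmx (chart_map (a := SA) j q)) = (fun q => chart_map j (pr q)).
  by apply/funext => q; exact: row_mxKl.
rewrite e1 e2 (mder_map gS gA smooth_map_proj); last exact: msmooth_coordinates.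
by rewrite -(rhoE u w).
Qed.

(** The value 0 at the origin is arbitrary: it makes the restriction of F to a
   fibre a function on a vector space, which can be differentiated. *)
Definition fibre (W : zmodType) (F : slit R n M -> W) (x : M) (y : 'rV[R]_n) : W :=
  if pselect (y != 0) is left y0 then F (mkslit x y0) else 0.

Lemma fibre_mkslit (W : zmodType) (F : slit R n M -> W) x y (y0 : y != 0) :
  fibre F x y = F (mkslit x y0).
Proof.
rewrite /fibre; case: pselect => [y0'|]; last by rewrite y0.
by congr F; apply/val_inj.
Qed.

Lemma fibreE (W : zmodType) (F : slit R n M -> W) u : fibre F (pr u) (eta u) = F u.
Proof. by rewrite (fibre_mkslit F _ (eta_neq0 u)); congr F; exact: slit_eq. Qed.

Lemma near_neq0 m (y : 'rV[R]_m) : y != 0 -> \forall z \near y, z != 0.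
Proof. by move=> y0; exact: (@cvgr_neq0 _ _ _ _ _ id y (@cvg_id _ (nbhs y)) y0). Qed.

Lemma local_rep_fibre (W : zmodType) (F : slit R n M -> W) x y : y != 0 ->
  local_rep (A := SA) (chart_at A x) F (row_mx (chart_map (chart_at A x) x) y) =
  fibre F x y.
Proof.
move=> y0; rewrite (fibre_mkslit F x y0).
have cu : chart_dom (a := SA) (chart_at A x) (mkslit x y0) by exact: (atlas_at gA x).
rewrite -[RHS](local_repE gS F cu); congr (local_rep _ _ _).
by rewrite /= /tangent_chart /= tcoord_self.
Qed.

Lemma chart_map_self u : chart_map (chart_at SA u) u =
  row_mx (chart_map (chart_at A (pr u)) (pr u)) (eta u).
Proof. by rewrite /= /tangent_chart tcoord_self. Qed.

(** On the fibre over its centre the induced chart is y |-> (const, y). *)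
Lemma mder_vertical (W : normedModType R) (F : slit R n M -> W) u v :
  mder SA F u (row_mx 0 v) = 'D_v (fibre F (pr u)) (eta u).
Proof.
rewrite /mder chart_map_self.
rewrite -(@derive_affine _ _ _ _ (local_rep (A := SA) (chart_at SA u) F)
  (row_mx (chart_map (chart_at A (pr u)) (pr u))) (row_mx 0 v) (eta u) v); last first.
  by move=> h; rewrite scale_row_mx add_row_mx scaler0 add0r.
apply: near_eq_derive; have := near_neq0 (eta_neq0 u); apply: filterS => y y0.
exact: local_rep_fibre.
Qed.

Lemma smooth_fibre (W : normedModType R) (F : slit R n M -> W) u :
  msmooth SA F u -> smooth_at (fibre F (pr u)) (eta u).
Proof.
rewrite /msmooth chart_map_self => sF.
apply: (@smooth_at_eq _ _ _ (fun y => local_rep (A := SA) (chart_at SA u) F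
  (row_mx (chart_map (chart_at A (pr u)) (pr u)) y))).
  have := near_neq0 (eta_neq0 u); apply: filterS => y y0.
  exact: local_rep_fibre.
apply: smooth_at_comp => //; apply: smooth_at_row_mx; first exact: smooth_at_cst.
by apply: smooth_at_lin => // y; exact: cvg_id.
Qed.

(** On a fibre the second component of an induced chart is linear, hence equal
   to its own differential. *)
Lemma tcoord_vertical (j : chart_index A) u v : chart_dom j (pr u) ->
  tcoord (A := SA) j u (row_mx 0 v) = row_mx 0 (tcoord j (pr u) v).
Proof.
move=> ju; rewrite -[LHS]hsubmxK lsubmx_tcoord// row_mxKl tcoord0.
congr row_mx.
have sj := @msmooth_coordinates _ _ _ SA gS j u ju.
have e1 : rsubmx (tcoord (A := SA) j u (row_mx 0 v)) =
    mder SA (fun q => rsubmx (chart_map (a := SA) j q)) u (row_mx 0 v).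
  symmetry; apply: (mder_lincomp gS _ _ _ sj); first exact: linearP.
  exact: rsubmx_cts.
rewrite e1 mder_vertical.
rewrite -[RHS](@derive_lin _ _ _ (tcoord j (pr u)) (eta u)); last exact: tcoord_linear.
apply: near_eq_derive; have := near_neq0 (eta_neq0 u); apply: filterS => y y0.
by rewrite (fibre_mkslit _ _ y0); exact: row_mxKr.
Qed.

(** In induced charts a function that comes from M depends on the first component
   only. *)
Lemma mder_proj (W : normedModType R) (F : M -> W) u w :
  mder SA (fun q => F (pr q)) u w = mder A F (pr u) (lsubmx w).
Proof.
have cu : chart_dom (a := SA) (chart_at SA u) u by exact: (atlas_at gA (pr u)).
have el q : lsubmx (chart_map (a := SA) (chart_at SA u) q) =
    chart_map (chart_at A (pr u)) (pr q) by exact: row_mxKl.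
rewrite /mder -(el u) -(@derive_affine _ _ _ _
  (local_rep (chart_at A (pr u)) F) (@lsubmx R 1 n n) (lsubmx w) _ w); last first.
  by move=> h; exact: linearP.
apply: near_eq_derive; apply: (@near_chart _ _ _ SA gS _ u _ cu) => q jq.
by rewrite (local_repE gS _ jq) el (local_repE gA _ (jq : chart_dom _ (pr q))).
Qed.

(** In a chart F is the restriction of its pullback to the vectors with the same
   components as u. *)
Lemma msmooth_descend (W : normedModType R) (F : M -> W) u :
  msmooth SA (fun q => F (pr q)) u -> msmooth A F (pr u).
Proof.
rewrite /msmooth chart_map_self => sF.
have cu := atlas_at gA (pr u).
apply: (@smooth_at_eq _ _ _ (fun a => local_rep (A := SA) (chart_at SA u)
  (fun q => F (pr q)) (row_mx a (eta u)))).
  apply: (near_chart gA cu) => x cx.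
  have y0 : tvec (chart_at A (pr u)) x (eta u) != 0.
    by rewrite -(@tcoord_neq0 (chart_at A (pr u)) x)// tvecK// eta_neq0.
  have cv : chart_dom (a := SA) (chart_at SA u) (mkslit x y0) by exact: cx.
  rewrite (local_repE gA F cx) -[RHS](local_repE gS (fun q => F (pr q)) cv).
  by congr (local_rep _ _ _); rewrite /= /tangent_chart /= tvecK.
apply: (smooth_at_comp (f := fun a => row_mx a (eta u))) => //.
apply: smooth_at_row_mx; last exact: smooth_at_cst.
by apply: smooth_at_lin => // y; exact: cvg_id.
Qed.

Lemma smooth_descend (F : M -> 'rV[R]_n) (e : 'rV[R]_n) : e != 0 ->
  smooth_pi_vfield A (fun u => F (pr u)) -> smooth_vfield A F.
Proof.
move=> e0 /(smooth_sectionP gS smooth_map_proj) sF.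
have [_ h] := smooth_sectionP gA (smooth_map_id gA) F; apply: h => x j jx.
exact: (@msmooth_descend _ (fun x => tcoord j x (F x)) (mkslit x e0) (sF (mkslit x e0) j jx)).
Qed.

Lemma smooth_gamma (X : slit R n M -> 'rV[R]_n) : smooth_pi_vfield A X ->
  smooth_vfield SA (fun u => gamma A u (X u)).
Proof.
move=> /(smooth_sectionP gS smooth_map_proj) sX.
apply: (smooth_section_local gS gS (smooth_map_id gS)) => u.
have cu : chart_dom (chart_at A (pr u)) (pr u) by exact: atlas_at.
exists (chart_at A (pr u)); first exact: cu.
have FB := @mnear_filter _ _ _ SA u.
apply: (@msmooth_near _ _ _ _ gS _ _
    (fun q => row_mx 0 (tcoord (chart_at A (pr u)) (pr q) (X q)))).
  have := @mnear_dom _ _ _ SA gS (chart_at A (pr u)) u cu.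
  by apply: filterS => q jq; rewrite gammaE tcoord_vertical.
exact: (msmooth_row_mx gS (msmooth_cst gS _ _) (sX _ _ cu)).
Qed.

Lemma smooth_basic (X : M -> 'rV[R]_n) : smooth_vfield A X ->
  smooth_pi_vfield A (fun u => X (pr u)).
Proof.
move=> /(smooth_sectionP gA (smooth_map_id gA)) sX.
have [_ h] := smooth_sectionP gS smooth_map_proj (fun u => X (pr u)); apply: h => u j ju.
exact: (msmooth_map gS gA smooth_map_proj (sX _ _ ju)).
Qed.

Lemma smooth_fun_basic (h : M -> R) : smooth_fun A h ->
  smooth_fun SA (fun u => h (pr u)).
Proof.
move=> /(smooth_funP gA) sh; apply/(smooth_funP gS) => u.
exact: (@msmooth_map _ _ _ _ _ _ _ gS gA _ smooth_map_proj R^o h u (sh (pr u))).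
Qed.

(** The first components of X and Y in an induced chart come from M, so that
   their derivatives involve only the projections of Y and X. *)
Lemma lsubmx_bracket (X Y : slit R n M -> 'rV[R]_(n + n)) (x y : M -> 'rV[R]_n) u :
  smooth_vfield SA X -> smooth_vfield SA Y ->
  (forall q, lsubmx (X q) = x (pr q)) -> (forall q, lsubmx (Y q) = y (pr q)) ->
  lsubmx (bracket SA X Y u) = bracket A x y (pr u).
Proof.
move=> sX sY Xx Yy.
have cu : chart_dom (chart_at A (pr u)) (pr u) by exact: atlas_at.
have half (Z : slit R n M -> 'rV[R]_(n + n)) (z : M -> 'rV[R]_n) w :
    smooth_vfield SA Z -> (forall q, lsubmx (Z q) = z (pr q)) ->
    lsubmx (mder SA (fun q => tcoord (chart_at SA u) q (Z q)) u w) =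
    mder A (fun q => tcoord (chart_at A (pr u)) q (z q)) (pr u) (lsubmx w).
  move=> /(smooth_sectionP gS (smooth_map_id gS)) sZ.
  move=> Zz.
  have {}sZ := sZ u (chart_at SA u) cu.
  rewrite -mder_proj.
  rewrite -(@mder_lincomp _ _ _ SA gS _ _ _ (@lsubmx R 1 n n) _ _ _ _ sZ);
    [|exact: linearP|exact: lsubmx_cts].
  apply: (mder_near gS); have FB := @mnear_filter _ _ _ SA u.
  have := @mnear_dom _ _ _ SA gS (chart_at A (pr u)) u cu.
  apply: filterS => q jq; apply: etrans (lsubmx_tcoord (Z q) jq) _.
  by rewrite Zz.
rewrite /bracket -Xx -Yy; apply: etrans (linearB _ _ _) _.
by congr (_ - _); apply: half.
Qed.

Lemma bracket0l (y : M -> 'rV[R]_n) x : bracket A (fun=> 0) y x = 0.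
Proof.
rewrite /bracket /= derive0 sub0r; apply/eqP; rewrite oppr_eq0; apply/eqP.
rewrite -[RHS](derive_cst (0 : 'rV[R]_n) (chart_map (chart_at A x) x) (y x)).
apply: near_eq_derive; apply: (near_chart gA (atlas_at gA x)) => q cq.
by rewrite (local_repE gA)// tcoord0.
Qed.

End Slit.

(** * Connectedness of the fibres *)

Section FibreConstancy.
Context {R : realType} (n : nat) (n2 : (2 <= n)%N).

Lemma exists_independent (y : 'rV[R]_n) : exists z : 'rV[R]_n, forall a, z <> a *: y.
Proof.
apply: contrapT => /forallNP h.
have {}h z : exists a : R, z = a *: y.
  by apply: contrapT => /forallNP hz; apply: (h z).
pose i0 := Ordinal (ltnW n2); pose i1 := Ordinal n2.
have [a /rowP ea] := h (delta_mx 0 i0); have [b /rowP eb] := h (delta_mx 0 i1).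
have := ea i0; have := ea i1; have := eb i1; rewrite !mxE !eqxx /=.
move=> e1 /esym/eqP; rewrite mulf_eq0 => /orP[] /eqP a0; last first.
  by move: e1; rewrite a0 mulr0 => /eqP; rewrite oner_eq0.
by rewrite a0 mul0r => /eqP; rewrite oner_eq0.
Qed.

(** For n >= 2 the complement of the origin is connected: two points are joined
   by at most two lines that avoid the origin. *)
Lemma constant_off_origin (F : 'rV[R]_n -> R^o) :
  (forall y, y != 0 -> differentiable F y) ->
  (forall y v, y != 0 -> 'D_v F y = 0) ->
  forall y y', y != 0 -> y' != 0 -> F y = F y'.
Proof.
move=> dF F0.
have line y z : y != 0 -> (forall a, z <> a *: y) -> F y = F z.
  move=> y0 yz.
  have nz (t : R) : t *: (z - y) + y != 0.
    apply/eqP => e.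
    have [t0|t0] := eqVneq t 0.
      by move: e y0; rewrite t0 scale0r add0r => ->; rewrite eqxx.
    apply: (yz (t^-1 * (t - 1))).
    rewrite -scalerA scalerBl scale1r.
    have -> : t *: y - y = t *: z.
      apply/eqP; rewrite -subr_eq0; apply/eqP.
      have -> : t *: y - y - t *: z = - (t *: (z - y) + y).
        by rewrite scalerBr opprD opprB addrAC.
      by rewrite e oppr0.
    by rewrite scalerA mulVf// scale1r.
  have dg (t : R) : is_derive t (1 : R) (fun t : R => F (t *: (z - y) + y) : R) 0.
    by rewrite -(F0 _ (z - y) (nz t)); apply: is_derive_line; exact/dF/nz.
  have := is_derive_0_is_cst 0 1 dg.
  by rewrite scale0r add0r scale1r subrK.
move=> y y' y0 y'0.
have [[a ya]|/forallNP yy'] := pselect (exists a, y' = a *: y); last exact: line.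
have [z hz] := exists_independent y.
rewrite (line _ _ y0 hz); symmetry; apply: line => // b.
by rewrite ya scalerA; exact: hz.
Qed.

End FibreConstancy.

(** * Extension of tangent vectors to vector fields *)

Section Frames.
Context {R : realType} (m : nat) (N : Type) (B : atlas R m N)
  (gB : good_atlas B).

Lemma mnear_neq0 (F : N -> R^o) p : msmooth B F p -> F p != 0 ->
  mnear B p (fun q => F q != 0).
Proof.
move=> sF F0; have cp := atlas_at gB p.
have n0 : \forall a \near chart_map (chart_at B p) p, local_rep (chart_at B p) F a != 0.
  apply: (@cvgr_neq0 _ R^o _ _ _ _ _ (smooth_at_cts sF)).
  by rewrite local_repE.
have FB := @mnear_filter _ _ _ B p.
apply: filterS2 (mnear_dom gB cp) (near_mnear gB cp n0) => q cq.
by rewrite local_repE.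
Qed.

(** In the chart i the components are phi times a constant; at the other points
   the field vanishes nearby. *)
Lemma smooth_cutoff_field (phi : N -> R) (i : chart_index B) (b : 'rV[R]_m) :
  smooth_fun B phi ->
  (forall p, mnear B p (fun q => phi q = 0) \/ chart_dom i p) ->
  smooth_vfield B (fun q => phi q *: tvec i q b).
Proof.
move=> /(smooth_funP gB) sphi dich.
apply: (smooth_section_local gB gB (smooth_map_id gB)) => p.
have FB := @mnear_filter _ _ _ B p.
case: (dich p) => [p0|ip].
  exists (chart_at B p); first exact: (atlas_at gB).
  apply: (@msmooth_near _ _ _ _ gB _ _ (fun=> 0)); last exact: msmooth_cst.
  by apply: filterS p0 => q ->; rewrite scale0r tcoord0.
exists i => //.
apply: (@msmooth_near _ _ _ _ gB _ _ (fun q => phi q *: b)).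
  by apply: filterS (mnear_dom gB ip) => q iq; rewrite (tcoordZ gB)//= tvecK.
by apply: (msmoothZ gB); [exact: sphi|exact: msmooth_cst].
Qed.

Lemma msmooth_mulmx a b c (F : N -> 'M[R]_(a, b)) (G : N -> 'M[R]_(b, c)) p :
  (forall k l, msmooth B (fun q => F q k l : R^o) p) ->
  (forall k l, msmooth B (fun q => G q k l : R^o) p) ->
  forall k l, msmooth B (fun q => (F q *m G q) k l : R^o) p.
Proof.
move=> sF sG k l; under eq_fun do rewrite mxE.
apply: (msmooth_sum gB) => j.
exact: (@msmoothZ _ _ _ _ gB R^o).
Qed.

End Frames.

(** * Horizontal lifts *)

Section Connection.
Context {R : realType} (n : nat) (M : topologicalType) (A : atlas R n M)
  (mA : smooth_manifold A)
  (D : (slit R n M -> 'rV[R]_n) -> slit R n M -> 'rV[R]_(n + n) -> 'rV[R]_n)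
  (lD : linear_connection (slit_atlas A) A (@slit_proj R n M) D)
  (rD : regular A D).

Local Notation SA := (slit_atlas A).
Local Notation pr := (@slit_proj R n M).
Let gA := manifold_good mA.
Let gS := slit_good gA.

Lemma vfield_extension x v : exists2 X, smooth_vfield A X & X x = v.
Proof.
have [phi [sphi phix dich]] := bump_function mA x.
have cx := atlas_at gA x.
exists (fun q => phi q *: tvec (chart_at A x) q ((phi x)^-1 *: v)).
  exact: smooth_cutoff_field.
rewrite -[RHS](tcoordK gA v cx) tcoord_self// /tvec.
rewrite derive_scale; last exact/smooth_at_diff/atlas_smooth.
by rewrite scalerA mulfV// scale1r.
Qed.

Lemma connection_linear s u : smooth_pi_vfield A s -> linear (D s u).
Proof. by case: lD => h _ _ _ ss a v w; exact: h. Qed.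

Lemma connection_mapP u : linear (connection_map D u).
Proof. exact: connection_linear (smooth_eta gA). Qed.

Lemma betaP u v : connection_map D u (beta A D u v) = 0 /\
  lsubmx (beta A D u v) = v.
Proof.
have [h _] := rD u.
have : exists w, connection_map D u w = 0 /\ rho A u w = v.
  have [v' [k [rv kk e]]] := h (row_mx v 0).
  exists k; split=> //; move: rv; rewrite !(rhoE gA).
  have : lsubmx (row_mx v (0 : 'rV[R]_n)) = v by exact: row_mxKl.
  by rewrite e linearD /= => ek r0; rewrite r0 add0r in ek.
by move=> /(xgetPex 0) [kb]; rewrite rhoE.
Qed.

Lemma beta_unique u v w : connection_map D u w = 0 -> lsubmx w = v ->
  beta A D u v = w.
Proof.
move=> kw lw; have [_ h] := rD u; have [kb lb] := betaP u v.
apply/eqP; rewrite -subr_eq0; apply/eqP; apply: h.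
  by rewrite (rhoE gA) linearB /= lb lw subrr.
rewrite -[beta A D u v - w]opprB opprB addrC -scaleN1r connection_mapP kb kw.
by rewrite scaler0 addr0.
Qed.

Lemma beta_linear u : linear (beta A D u).
Proof.
move=> a v w; have [kv lv] := betaP u v; have [kw lw] := betaP u w.
apply: beta_unique; first by rewrite connection_mapP kv kw scaler0 addr0.
by rewrite linearP /= lv lw.
Qed.

Lemma horizontal_vertical u w : exists v,
  w = beta A D u (lsubmx w) + gamma A u v.
Proof.
exists (rsubmx (w - beta A D u (lsubmx w))); rewrite (gammaE gA).
have -> : (0 : 'rV[R]_n) = lsubmx (w - beta A D u (lsubmx w)).
  by have [_ lb] := betaP u (lsubmx w); rewrite linearB /= lb subrr.
by rewrite hsubmxK addrC subrK.
Qed.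

(** In a chart, let H and T be the matrices of the connection map on the
   horizontal and on the vertical coordinate vectors.  Their entries are smooth,
   being derivatives of the fundamental section along cut-off coordinate fields,
   and regularity makes T invertible.  The lift of a vector with components xi
   has components (xi, omega) with xi H + omega T = 0, so that omega is
   - xi H T ^ -1. *)
Lemma smooth_beta (X : slit R n M -> 'rV[R]_n) : smooth_pi_vfield A X ->
  smooth_vfield SA (fun u => beta A D u (X u)).
Proof.
move=> sX; apply: (smooth_section_local gS gS (smooth_map_id gS)) => u.
pose c : chart_index A := chart_at A (pr u).
have cu : chart_dom c (pr u) by exact: (atlas_at gA).
exists c; first exact: cu.
have [phi [sphi phiu dich]] := bump_function mA (pr u).
have sphiS := smooth_fun_basic gA sphi.
(* A global extension, up to the factor phi, of the coordinate vector k. *)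
pose E k q := phi (pr q) *: tvec (A := SA) c q (delta_mx 0 k).
have sE k : smooth_vfield SA (E k).
  apply: smooth_cutoff_field => //= q; case: (dich (pr q)) => [q0|]; last by right.
  by left; exact: (mnear_map gS gA (smooth_map_proj gA) q0).
pose sg k q := tcoord c (pr q) (D (@eta R n M) q (E k q)).
have ssg k : msmooth SA (sg k) u.
  have [_ _ _ h4] := lD; have := h4 _ _ (sE k) (smooth_eta gA).
  by move=> /(smooth_sectionP gS (smooth_map_proj gA)); apply.
pose H q : 'M[R]_n := \matrix_(k, l) sg (lshift n k) q 0 l.
pose T q : 'M[R]_n := \matrix_(k, l) sg (rshift n k) q 0 l.
pose ell q b := tcoord c (pr q) (connection_map D q (tvec (A := SA) c q b)).
have tvl q : chart_dom c (pr q) -> linear (tvec (A := SA) c q).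
  move=> cq a b d; apply: derive_linear; apply: smooth_at_diff.
  apply: (atlas_smooth gS) => //; exact: (atlas_at gS).
have ellE q b : chart_dom c (pr q) ->
    phi (pr q) *: ell q b = lsubmx b *m H q + rsubmx b *m T q.
  move=> cq.
  have lell : linear (ell q).
    by move=> a b1 b2; rewrite /ell tvl// connection_mapP (tcoord_linear gA).
  pose eM := GRing.isLinear.Build R _ _ _ (ell q) lell.
  pose eL : {linear 'rV[R]_(n + n) -> 'rV[R]_n} := HB.pack (ell q) eM.
  have sgE k : sg k q = phi (pr q) *: ell q (delta_mx 0 k).
    rewrite /sg /E -[D _ _ _]/(connection_map D q _).
    have := connection_mapP q (phi (pr q)) (tvec (A := SA) c q (delta_mx 0 k)) 0.
    have -> : connection_map D q 0 = 0.
      by have := connection_mapP q (-1) 0 0; rewrite scaler0 addr0 scaleN1r addNr.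
    by rewrite !addr0 => ->; rewrite (tcoordZ gA).
  have eb : ell q b = \sum_k b 0 k *: ell q (delta_mx 0 k).
    rewrite -[ell q]/(eL : _ -> _) {1}(row_sum_delta b) linear_sum.
    by apply: eq_bigr => k _; rewrite linearZ.
  rewrite eb scaler_sumr big_split_ord /=; congr (_ + _).
    rewrite mulmx_sum_row; apply: eq_bigr => k _.
    rewrite scalerA mulrC -scalerA -sgE mxE; congr (_ *: _).
    by apply/rowP => l; rewrite !mxE.
  rewrite mulmx_sum_row; apply: eq_bigr => k _.
  rewrite scalerA mulrC -scalerA -sgE mxE; congr (_ *: _).
  by apply/rowP => l; rewrite !mxE.
have lsubt q b : chart_dom c (pr q) -> tcoord c (pr q) (lsubmx (tvec (A := SA) c q b)) = lsubmx b.
  move=> cq; rewrite -(lsubmx_tcoord gA)//; congr lsubmx.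
  exact: (tvecK gS).
(* A vector with components (0, w) killed by T is vertical and in the kernel of
   the connection map. *)
have uT q : chart_dom c (pr q) -> phi (pr q) != 0 -> T q \in unitmx.
  move=> cq p0; rewrite -row_free_unit; apply: inj_row_free => w wT.
  have l0 : ell q (row_mx 0 w) = 0.
    have := ellE q (row_mx 0 w) cq; rewrite row_mxKl row_mxKr mul0mx wT addr0.
    by move=> /eqP; rewrite scaler_eq0 (negbTE p0) => /eqP.
  have k0 : connection_map D q (tvec (A := SA) c q (row_mx 0 w)) = 0.
    by rewrite -[LHS](tcoordK gA _ cq) -/(ell _ _) l0 /tvec derive0.
  have s0 : lsubmx (tvec (A := SA) c q (row_mx 0 w)) = 0.
    by rewrite -[LHS](tcoordK gA _ cq) lsubt// row_mxKl /tvec derive0.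
  have [_ h] := rD q.
  have t0 : tvec (A := SA) c q (row_mx 0 w) = 0 by apply: h => //; rewrite (rhoE gA).
  have := tvecK gS (row_mx 0 w) (cq : chart_dom (a := SA) c q).
  rewrite t0 tcoord0 => /esym /(congr1 rsubmx).
  by rewrite row_mxKr linear0.
pose xi q := tcoord c (pr q) (X q).
have sxi : msmooth SA xi u.
  by move: sX => /(smooth_sectionP gS (smooth_map_proj gA)); apply.
apply: (@msmooth_near _ _ _ _ gS _ _
    (fun q => row_mx (xi q) (- (xi q *m H q *m invmx (T q))))).
  have FB := @mnear_filter _ _ _ SA u.
  have np := mnear_neq0 gS ((smooth_funP gS _).1 sphiS u) phiu.
  apply: filterS2 (@mnear_dom _ _ _ SA gS c u cu) np => q cq q0.
  have [kb lb] := betaP q (X q).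
  have lxi : lsubmx (tcoord (A := SA) c q (beta A D q (X q))) = xi q.
    by apply: etrans (lsubmx_tcoord gA (beta A D q (X q)) cq) _; rewrite lb.
  have := ellE q (tcoord (A := SA) c q (beta A D q (X q))) cq.
  rewrite /ell (tcoordK gS)// kb tcoord0 scaler0 lxi => /esym e.
  rewrite -[RHS]hsubmxK lxi; congr row_mx.
  rewrite -[RHS](mulmxK (uT q cq q0)) -mulNmx; congr (_ *m _).
  by apply/eqP; rewrite eq_sym -addr_eq0 addrC; apply/eqP.
apply: (msmooth_row_mx gS) => //; apply/(msmooth_rV gS) => l.
have sxe k j : msmooth SA (fun q => xi q k j : R^o) u.
  by rewrite ord1; exact: ((msmooth_rV gS _ _).1 sxi j).
have sT k j : msmooth SA (fun q => T q k j : R^o) u.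
  by under eq_fun do rewrite mxE; exact: ((msmooth_rV gS _ _).1 (ssg _) j).
have sH k j : msmooth SA (fun q => H q k j : R^o) u.
  by under eq_fun do rewrite mxE; exact: ((msmooth_rV gS _ _).1 (ssg _) j).
have si := msmooth_invmx gS (uT u cu phiu) sT.
have sp := msmooth_mulmx gS (msmooth_mulmx gS sxe sH) si.
have := msmoothZ gS (msmooth_cst gS (-1 : R^o) u) (sp 0 l).
by under eq_fun do rewrite scaleN1r; under [X in _ -> msmooth SA X _]eq_fun do rewrite mxE.
Qed.

End Connection.

(** * The Finsler metric *)

Lemma mder_cst {R : realType} (m : nat) (N : Type) (B : atlas R m N)
    (gB : good_atlas B) (W : normedModType R) (a : W) p v :
  mder B (fun=> a) p v = 0.
Proof.
rewrite -[RHS](derive_cst a (chart_map (chart_at B p) p) v).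
by apply: near_eq_derive; apply: (near_chart gB (atlas_at gB p)) => q cq;
  rewrite (local_repE gB).
Qed.

Section Metric.
Context {R : realType} (n : nat) (M : Type) (A : atlas R n M)
  (gA : good_atlas A) (L : M -> 'rV[R]_n -> R) (fL : finsler A L).

Local Notation SA := (slit_atlas A).
Local Notation pr := (@slit_proj R n M).
Local Notation g := (finsler_metric L).
Let gS := slit_good gA.

Definition energy (x : M) (y : 'rV[R]_n) : R^o := L x y ^+ 2.

Lemma smooth_energy x y : y != 0 -> smooth_at (energy x) y.
Proof.
move=> y0; have [sL _ _ _] := fL.
have := smooth_fibre gA ((smooth_funP gS _).1 sL (mkslit x y0)).
rewrite /= => sf.
apply: (@smooth_at_eq _ _ _ (fun z => fibre (fun u => L (pr u) (eta u) : R^o) x z *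
    fibre (fun u => L (pr u) (eta u) : R^o) x z : R^o)).
  apply: filterS (near_neq0 y0) => z z0.
  by rewrite (fibre_mkslit _ _ z0) /energy expr2.
exact: smooth_atM.
Qed.

Lemma metricC u v w : g u v w = g u w v.
Proof.
have h := derive_symmetric v w (smooth_energy (pr u) (eta_neq0 u)).
exact: (congr1 (fun z => 2^-1 * z) h).
Qed.

Lemma metric_linearl u w : linear (g u ^~ w : _ -> R^o).
Proof.
move=> a v v'.
have dw := smooth_at_diff (smooth_at_derive w (smooth_energy (pr u) (eta_neq0 u))).
have h := derive_linear a v v' dw.
apply: etrans (congr1 (fun z : R^o => 2^-1 *: z) h) _.
rewrite scalerDr scalerA mulrC -scalerA; exact: erefl.
Qed.

Lemma metricDl u v v' w : g u (v + v') w = g u v w + g u v' w.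
Proof.
by have := metric_linearl u w 1 v v'; rewrite /= !scale1r.
Qed.

Lemma metric0l u w : g u 0 w = 0.
Proof. by apply: (@addrI _ (g u 0 w)); rewrite -metricDl !addr0. Qed.

Lemma metricZl u a v w : g u (a *: v) w = a * g u v w.
Proof.
by have := metric_linearl u w a v 0; rewrite /= metric0l !addr0.
Qed.

Lemma metricNl u v w : g u (- v) w = - g u v w.
Proof. by rewrite -scaleN1r metricZl mulN1r. Qed.

Lemma metricDr u v w w' : g u v (w + w') = g u v w + g u v w'.
Proof. by rewrite metricC metricDl !(metricC u v). Qed.

Lemma metric0r u v : g u v 0 = 0.
Proof. by rewrite metricC metric0l. Qed.

Lemma metricZr u a v w : g u v (a *: w) = a * g u v w.
Proof. by rewrite metricC metricZl (metricC u v). Qed.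

Lemma metricNr u v w : g u v (- w) = - g u v w.
Proof. by rewrite metricC metricNl (metricC u v). Qed.

Lemma metric_eq0 u v : g u v v = 0 -> v = 0.
Proof.
move=> gv; apply/eqP/negPn/negP => v0; have [_ _ _ gp] := fL.
by have := gp u v v0; rewrite gv ltxx.
Qed.

Lemma metric_sum_delta u v w :
  g u v w = \sum_j w 0 j * g u v (delta_mx 0 j).
Proof.
rewrite {1}(row_sum_delta w).
elim: (index_enum _) => [|j r IH]; first by rewrite !big_nil metric0r.
by rewrite !big_cons metricDr metricZr IH.
Qed.

(** Along one fibre the components of s and t are smooth functions, and the
   coefficients of the metric are second derivatives of the energy. *)
Lemma smooth_metric_fibre s t u : smooth_pi_vfield A s -> smooth_pi_vfield A t ->
  smooth_at (fibre (fun q => g q (s q) (t q) : R^o) (pr u)) (eta u).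
Proof.
move=> /(smooth_sectionP gS (smooth_map_proj gA)) ss.
move=> /(smooth_sectionP gS (smooth_map_proj gA)) st.
have cu := atlas_at gA (pr u).
have {}ss := smooth_fibre gA (ss u _ cu); have {}st := smooth_fibre gA (st u _ cu).
pose fs := fibre (fun q => tcoord (chart_at A (pr u)) (pr q) (s q)) (pr u).
pose ft := fibre (fun q => tcoord (chart_at A (pr u)) (pr q) (t q)) (pr u).
apply: (@smooth_at_eq _ _ _ (fun y => \sum_j ft y 0 j *
  (2^-1 * 'D_(fs y) ('D_(delta_mx 0 j) (energy (pr u))) y) : R^o)).
  apply: filterS (near_neq0 (eta_neq0 u)) => y y0.
  have fsE : fs y = s (mkslit (pr u) y0).
    by rewrite /fs (fibre_mkslit _ _ y0); exact: (tcoord_self gA).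
  have ftE : ft y = t (mkslit (pr u) y0).
    by rewrite /ft (fibre_mkslit _ _ y0); exact: (tcoord_self gA).
  rewrite fsE ftE (fibre_mkslit _ _ y0).
  apply: etrans (esym (metric_sum_delta (mkslit (pr u) y0)
    (s (mkslit (pr u) y0)) (t (mkslit (pr u) y0)))).
  apply: eq_bigr => j _; congr (_ * _).
apply: smooth_at_sum => j; apply: smooth_atM; first exact: (smooth_at_rV _ _).1.
apply: smooth_atM; first exact: smooth_at_cst.
have sid : smooth_at (fun y : 'rV[R]_n => y) (eta u).
  by apply: smooth_at_lin => // y; exact: cvg_id.
have sE := smooth_at_derive (delta_mx 0 j) (smooth_energy (pr u) (eta_neq0 u)).
exact: (smooth_at_diff_map sE sid ss).
Qed.

(** For n >= 2 the fibres are connected, so that a vanishing vertical derivative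
   makes f constant on each of them. *)
Lemma constant_on_fibres (n2 : (2 <= n)%N) (f : slit R n M -> R^o) :
  (forall u, smooth_at (fibre f (pr u)) (eta u)) ->
  (forall u v, mder SA f u (gamma A u v) = 0) ->
  forall u u', pr u = pr u' -> f u = f u'.
Proof.
move=> sf f0 u u' uu'; rewrite -(fibreE f u) -(fibreE f u') -uu'.
apply: (constant_off_origin n2); [| |exact: eta_neq0|exact: eta_neq0].
  by move=> y y0; exact: smooth_at_diff (sf (mkslit (pr u) y0)).
move=> y v y0.
have := f0 (mkslit (pr u) y0) v; rewrite (gammaE gA) => h.
by apply: etrans (esym (mder_vertical gA f (mkslit (pr u) y0) v)) h.
Qed.

End Metric.

(** * The h-curvature and concurrent fields *)

Section Cartan.
Context {R : realType} (n : nat) (M : topologicalType) (A : atlas R n M)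
  (mA : smooth_manifold A) (L : M -> 'rV[R]_n -> R) (fL : finsler A L)
  (n2 : (2 <= n)%N)
  (D : (slit R n M -> 'rV[R]_n) -> slit R n M -> 'rV[R]_(n + n) -> 'rV[R]_n)
  (cD : cartan_connection A L D).

Local Notation SA := (slit_atlas A).
Local Notation pr := (@slit_proj R n M).
Local Notation g := (finsler_metric L).
Local Notation smooth X := (smooth_pi_vfield A X).
Let gA := manifold_good mA.
Let gS := slit_good gA.
Let lD : linear_connection SA A pr D. Proof. by case: cD. Qed.
Let rD : regular A D. Proof. by case: cD. Qed.
Local Notation beta := (beta A D).
Local Notation gamma := (@gamma R n M A).

Lemma pi_extension u v : exists2 X, smooth_vfield A X & X (pr u) = v.
Proof. exact: vfield_extension. Qed.

Lemma connectionD s u v w : smooth s -> D s u (v + w) = D s u v + D s u w.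
Proof. by move=> ss; have := connection_linear lD u ss 1 v w; rewrite !scale1r. Qed.

Lemma connection_zero_section u w : D (fun=> 0) u w = 0.
Proof.
have s0 := smooth_section_cst0 gS gA (smooth_map_proj gA).
have [_ h _ _] := lD; have := h _ _ s0 s0 u w.
have -> : (fun q : slit R n M => (0 : 'rV[R]_n) + 0) = (fun=> 0).
  by apply/funext => q; rewrite addr0.
by move=> e; apply: (@addrI _ (D (fun=> 0) u w)); rewrite addr0 -e.
Qed.

Lemma connectionN s u w : smooth s -> D (fun q => - s q) u w = - D s u w.
Proof.
move=> ss; have [_ _ h _] := lD.
have := h _ _ (smooth_fun_cst gS (-1)) ss u w.
have -> : (fun q => -1 *: s q) = (fun q => - s q).
  by apply/funext => q; rewrite scaleN1r.
by move=> ->; rewrite [X in X *: _](mder_cst gS) scale0r add0r scaleN1r.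
Qed.

Lemma metric_derivative X s t u : smooth_vfield SA X -> smooth s -> smooth t ->
  mder SA (fun q => g q (s q) (t q) : R^o) u (X u) =
  g u (D s u (X u)) (t u) + g u (s u) (D t u (X u)).
Proof.
move=> sX ss st; have [_ _ h _ _] := cD.
by rewrite -(h X s t sX ss st u).
Qed.

(** This is the vanishing of the horizontal torsion. *)
Lemma h_bracket X Y u : smooth X -> smooth Y ->
  lsubmx (bracket SA (fun q => beta q (X q)) (fun q => beta q (Y q)) u) =
  D Y u (beta u (X u)) - D X u (beta u (Y u)).
Proof.
case: cD => _ _ _ h _ sX sY; have := h X Y sX sY u.
have bE Z : (fun q => tmap SA A pr q (beta q (Z q))) = Z.
  by apply/funext => q; rewrite -[LHS]/(rho A q _) (rhoE gA) (betaP mA rD _ _).2.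
have rE w : tmap SA A pr u w = lsubmx w := rhoE gA u w.
move/eqP; rewrite subr_eq0 => /eqP e.
apply: etrans (esym (rE _)) _; apply: etrans (esym e) _; congr (_ - _).
  exact: (congr1 (fun s => D s u _) (bE Y)).
exact: (congr1 (fun s => D s u _) (bE X)).
Qed.

Section Concurrent.
Context (zeta : slit R n M -> 'rV[R]_n) (cz : concurrent A D zeta).

Let sz : smooth zeta. Proof. by case: cz. Qed.

Lemma concurrent_beta u v : D zeta u (beta u v) = - v.
Proof.
have [X sX <-] := pi_extension u v.
by have [h _] := cz.2 _ (smooth_basic gA sX) u.
Qed.

Lemma concurrent_gamma u v : D zeta u (gamma u v) = 0.
Proof.
have [X sX <-] := pi_extension u v.
by have [_ h] := cz.2 _ (smooth_basic gA sX) u.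
Qed.

Lemma concurrent_derivative u w : D zeta u w = - lsubmx w.
Proof.
have [v e] := horizontal_vertical mA rD u w.
by rewrite {1}e (connectionD _ _ _ sz) concurrent_beta concurrent_gamma addr0.
Qed.

(** Since D_w zeta = - rho w, the curvature applied to zeta is the horizontal
   torsion. *)
Lemma curvature_concurrent X Y u : smooth X -> smooth Y ->
  h_curvature A D X Y zeta u = 0.
Proof.
move=> sX sY; rewrite /h_curvature /curvature concurrent_derivative h_bracket//.
have zE Z : (fun q => D zeta q (beta q (Z q))) = (fun q => - Z q).
  by apply/funext => q; rewrite concurrent_beta.
rewrite !zE !connectionN// opprK opprB.
by rewrite addrA subrK subrr.
Qed.

(** Where k0 does not vanish, isotropy and R(X, Y) zeta = 0 force zeta = 0; but
   a concurrent field vanishes on no open set. *)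
Lemma isotropy_factor_eq0 (k0 : slit R n M -> R) : smooth_fun SA k0 ->
  (forall X Y Z, smooth X -> smooth Y -> smooth Z -> forall u,
     h_curvature A D X Y Z u =
     k0 u *: (g u (X u) (Z u) *: Y u - g u (Y u) (Z u) *: X u)) ->
  forall u, k0 u = 0.
Proof.
move=> /(smooth_funP gS) sk iso u; apply/eqP/negPn/negP => ku.
have FB := @mnear_filter _ _ _ SA u.
have zeta0 q : k0 q != 0 -> zeta q = 0.
  move=> kq; have [z zi] := exists_independent n2 (zeta q).
  have [Y sY Yq] := pi_extension q z.
  have := iso _ _ _ sz (smooth_basic gA sY) sz q.
  rewrite (curvature_concurrent q sz (smooth_basic gA sY)).
  move=> /esym/eqP; rewrite scaler_eq0 (negbTE kq) /= subr_eq0 Yq => /eqP e.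
  apply: (metric_eq0 fL (u := q)); apply/eqP/negPn/negP => gz.
  apply: (zi ((g q (zeta q) (zeta q))^-1 * g q z (zeta q))).
  by rewrite -scalerA -e scalerA mulVf// scale1r.
have [X sX Xu] := pi_extension u (eta u).
have sX' := smooth_basic gA sX.
have := metric_derivative u (smooth_beta mA lD rD sX') sX' sz.
have -> : mder SA (fun q => g q (X (pr q)) (zeta q) : R^o) u
    (beta u (X (pr u))) = 0.
  rewrite -[RHS](mder_cst gS (0 : R^o) u (beta u (X (pr u)))).
  apply: (mder_near gS); apply: filterS (mnear_neq0 gS (sk u) ku) => q kq.
  by rewrite zeta0// (metric0r gA fL).
rewrite concurrent_beta zeta0// (metric0r gA fL) add0r (metricNr gA fL) Xu.
move=> /eqP; rewrite eq_sym oppr_eq0 => /eqP /(metric_eq0 fL) /eqP.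
by rewrite (negbTE (eta_neq0 u)).
Qed.

Lemma isotropic_curvature_eq0 : h_isotropic A L D ->
  forall X Y Z, smooth X -> smooth Y -> smooth Z -> forall u,
    h_curvature A D X Y Z u = 0.
Proof.
move=> [k0 sk iso] X Y Z sX sY sZ u.
by rewrite iso// (isotropy_factor_eq0 sk iso) scale0r.
Qed.

End Concurrent.
End Cartan.

(** * The torsion on a Berwald manifold *)

Lemma self_opposite_eq0 (F : realFieldType) (s : F) : s = - s -> s = 0.
Proof. by move=> e; lra. Qed.

Lemma subr_eq_opp (V : zmodType) (p p' q q' : V) :
  p + q = p' + q' -> p - p' = - (q - q').
Proof.
by move=> e; apply/eqP; rewrite opprB subr_eq addrAC (addrC q') -e addrK.
Qed.

Section Berwald.
Context {R : realType} (n : nat) (M : topologicalType) (A : atlas R n M)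
  (mA : smooth_manifold A) (L : M -> 'rV[R]_n -> R) (fL : finsler A L)
  (n2 : (2 <= n)%N)
  (D : (slit R n M -> 'rV[R]_n) -> slit R n M -> 'rV[R]_(n + n) -> 'rV[R]_n)
  (cD : cartan_connection A L D).

Local Notation SA := (slit_atlas A).
Local Notation pr := (@slit_proj R n M).
Local Notation g := (finsler_metric L).
Local Notation smooth X := (smooth_pi_vfield A X).
Let gA := manifold_good mA.
Let gS := slit_good gA.
Let lD : linear_connection SA A pr D. Proof. by case: cD. Qed.
Let rD : regular A D. Proof. by case: cD. Qed.
Local Notation beta := (beta A D).
Local Notation gamma := (@gamma R n M A).

(** The bracket of a vertical field with the lift of a basic field is vertical,
   as the bracket of their projections 0 and x is 0. *)
Lemma hv_torsion_basic V x u : smooth V -> smooth_vfield A x ->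
  hv_torsion A D V (fun q => x (pr q)) u = D (fun q => x (pr q)) u (gamma u (V u)).
Proof.
move=> sV sx; have sx' := smooth_basic gA sx.
have rE q w : tmap SA A pr q w = lsubmx w := rhoE gA q w.
have bE : (fun q => tmap SA A pr q (beta q (x (pr q)))) = (fun q => x (pr q)).
  by apply/funext => q; rewrite rE (betaP mA rD _ _).2.
have cE : (fun q => tmap SA A pr q (gamma q (V q))) = (fun=> 0).
  by apply/funext => q; rewrite rE (gammaE gA) row_mxKl.
have br : lsubmx (bracket SA (fun q => gamma q (V q))
    (fun q => beta q (x (pr q))) u) = 0.
  rewrite (lsubmx_bracket gA (x := fun=> 0) (y := x)).
  - exact: bracket0l.
  - exact: smooth_gamma.
  - exact: smooth_beta.
  - by move=> q; rewrite (gammaE gA) row_mxKl.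
  - by move=> q; rewrite (betaP mA rD _ _).2.
transitivity (D (fun q => x (pr q)) u (gamma u (V u)) -
    D (fun=> 0) u (beta u (x (pr u))) - 0).
  congr (_ - _ - _).
  - exact: (congr1 (fun s => D s u _) bE).
  - exact: (congr1 (fun s => D s u _) cE).
  - by apply: etrans br; exact: rE.
by rewrite (connection_zero_section mA cD) !subr0.
Qed.

Lemma metric_derivative_gamma s t u v : smooth s -> smooth t ->
  mder SA (fun q => g q (s q) (t q) : R^o) u (gamma u v) =
  g u (D s u (gamma u v)) (t u) + g u (s u) (D t u (gamma u v)).
Proof.
move=> ss st; have [V sV <-] := pi_extension mA u v.
have h := metric_derivative cD u (smooth_gamma gA (smooth_basic gA sV)) ss st.
exact: h.
Qed.

Lemma metric_derivative_beta s t u v : smooth s -> smooth t ->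
  mder SA (fun q => g q (s q) (t q) : R^o) u (beta u v) =
  g u (D s u (beta u v)) (t u) + g u (s u) (D t u (beta u v)).
Proof.
move=> ss st; have [V sV <-] := pi_extension mA u v.
exact: (metric_derivative cD u (smooth_beta mA lD rD (smooth_basic gA sV)) ss st).
Qed.

Lemma metric_nondegenerate u v :
  (forall x, smooth_vfield A x -> g u v (x (pr u)) = 0) -> v = 0.
Proof.
move=> h; have [x sx xu] := pi_extension mA u v.
by apply: (metric_eq0 fL (u := u)); rewrite -{2}xu; exact: h.
Qed.

Definition reference_vector : 'rV[R]_n := const_mx 1.

Lemma reference_vector_neq0 : reference_vector != 0.
Proof.
apply/eqP => /rowP /(_ (Ordinal n2)); rewrite !mxE => /eqP.
by rewrite oner_eq0.
Qed.

(** One nonzero vector over each point, chosen without regard to continuity. *)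
Definition section_point (x : M) : slit R n M := mkslit x reference_vector_neq0.

(** Such an f comes from a function on M, whose derivative along x (pr u) this
   is. *)
Lemma mder_beta_constant (f : slit R n M -> R^o) u u' (x : M -> 'rV[R]_n) :
  (forall q q', pr q = pr q' -> f q = f q') -> pr u = pr u' ->
  mder SA f u (beta u (x (pr u))) = mder SA f u' (beta u' (x (pr u'))).
Proof.
move=> fc uu'.
have fE : f = (fun q => f (section_point (pr q))).
  by apply/funext => q; exact: fc.
rewrite fE (mder_proj gA (fun p => f (section_point p)) u).
rewrite (mder_proj gA (fun p => f (section_point p)) u').
by rewrite !(betaP mA rD _ _).2 uu'.
Qed.

(** The squared length of zeta is constant on the fibres, hence so are its
   horizontal derivatives - 2 g(x, zeta) along basic fields x; the vertical
   derivative of the latter is g(T(V, x), zeta). *)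
Lemma hv_torsion_concurrent zeta V u : concurrent A D zeta -> smooth V ->
  hv_torsion A D V zeta u = 0.
Proof.
move=> cz sV; have sz : smooth zeta by case: cz.
have zc : forall q q', pr q = pr q' ->
    g q (zeta q) (zeta q) = g q' (zeta q') (zeta q') :> R^o.
  apply: (constant_on_fibres gA n2 (f := fun q => g q (zeta q) (zeta q))).
    by move=> q; exact: (smooth_metric_fibre gA fL q sz sz).
  move=> q v; rewrite metric_derivative_gamma// (concurrent_gamma mA cz).
  by rewrite (metric0l gA fL) (metric0r gA fL) addr0.
have gx x : smooth_vfield A x -> forall q q', pr q = pr q' ->
    g q (x (pr q)) (zeta q) = g q' (x (pr q')) (zeta q') :> R^o.
  move=> sx q q' qq'; have := mder_beta_constant x zc qq'.
  have dE p v : mder SA (fun q => g q (zeta q) (zeta q) : R^o) p (beta p v) =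
      - (g p v (zeta p) + g p v (zeta p)).
    rewrite (metric_derivative_beta p v sz sz) (concurrent_beta mA cz).
    by rewrite (metricNl gA fL) (metricNr gA fL) (metricC gA fL p (zeta p)) opprD.
  rewrite (dE q) (dE q').
  move: (g q _ _) (g q' _ _) => a b /oppr_inj; rewrite -!mulr2n => e.
  by apply: (mulIf (x := 2%:R)); rewrite ?pnatr_eq0// !mulr_natr.
apply: metric_nondegenerate => x sx; have sx' := smooth_basic gA sx.
have [_ _ _ _ sym] := cD; apply: etrans (sym _ _ _ sV sz sx' u) _.
rewrite (hv_torsion_basic u sV sx).
have := metric_derivative_gamma u (V u) sx' sz.
rewrite (concurrent_gamma mA cz) (metric0r gA fL) addr0 => <-.
have fE : (fun q => g q (x (pr q)) (zeta q) : R^o) =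
    (fun q => (fun p => g (section_point p) (x p) (zeta (section_point p))) (pr q)).
  by apply/funext => q; exact: (gx x sx q (section_point (pr q)) erefl).
rewrite fE (mder_proj gA (fun p => g (section_point p) (x p) (zeta (section_point p)) : R^o)).
by rewrite (gammaE gA) row_mxKl /mder derive0.
Qed.

Section Flat.
Context (zeta : slit R n M -> 'rV[R]_n) (cz : concurrent A D zeta)
  (bD : berwald A D).

(** Differentiating T(Y, zeta) = 0 horizontally along X leaves T(Y, X) = 0. *)
Lemma hv_torsion_berwald X Y u : smooth X -> smooth Y ->
  hv_torsion A D Y X u = 0.
Proof.
move=> sX sY; have sz : smooth zeta by case: cz.
(* The lift of - X is used because D zeta maps it to X. *)
have sN := smooth_sectionN gS gA (smooth_map_proj gA) sX.
have := bD sN sY sz u; rewrite /=.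
have -> : (fun q => D zeta q (beta q (- X q))) = X.
  by apply/funext => q; rewrite (concurrent_beta mA cz) opprK.
have -> : hv_torsion A D Y zeta = (fun=> 0).
  by apply/funext => q; exact: hv_torsion_concurrent.
have [_ _ _ h] := lD.
have sDY : smooth (fun q => D Y q (beta q (- X q))).
  exact: h (smooth_beta mA lD rD sN) sY.
rewrite (hv_torsion_concurrent u cz sDY) (connection_zero_section mA cD).
by rewrite subr0 sub0r => /eqP; rewrite oppr_eq0 => /eqP.
Qed.

Lemma connection_gamma_basic x u v : smooth_vfield A x ->
  D (fun q => x (pr q)) u (gamma u v) = 0.
Proof.
move=> sx; have [V sV <-] := pi_extension mA u v.
rewrite -(hv_torsion_basic u (smooth_basic gA sV) sx).
by apply: hv_torsion_berwald; exact: smooth_basic.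
Qed.

(** Basic fields are vertically parallel, so that their scalar products have no
   vertical derivative. *)
Lemma metric_basic x y : smooth_vfield A x -> smooth_vfield A y ->
  forall u u', pr u = pr u' ->
  g u (x (pr u)) (y (pr u)) = g u' (x (pr u')) (y (pr u')) :> R^o.
Proof.
move=> sx sy; have sx' := smooth_basic gA sx; have sy' := smooth_basic gA sy.
apply: (constant_on_fibres gA n2 (f := fun q => g q (x (pr q)) (y (pr q)))).
  by move=> q; exact: (smooth_metric_fibre gA fL q sx' sy').
move=> q v; rewrite (metric_derivative_gamma q v sx' sy').
rewrite (connection_gamma_basic q v sx) (connection_gamma_basic q v sy).
by rewrite (metric0l gA fL) (metric0r gA fL) addr0.
Qed.

Lemma metric_riemannian : riemannian L.
Proof.
move=> u u' uu'; apply/funext => v; apply/funext => w.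
have [x sx <-] := pi_extension mA u v; have [y sy <-] := pi_extension mA u w.
by rewrite {3 4}uu'; exact: metric_basic.
Qed.

(** The difference of the values at two vectors over the same point is symmetric
   in x and y, and antisymmetric in y and z after pairing with z: it vanishes,
   as in the uniqueness of the Levi-Civita connection. *)
Lemma connection_beta_basic x y : smooth_vfield A x -> smooth_vfield A y ->
  forall u u', pr u = pr u' ->
  D (fun q => y (pr q)) u (beta u (x (pr u))) =
  D (fun q => y (pr q)) u' (beta u' (x (pr u'))).
Proof.
move=> sx sy u u' uu'.
pose a y x v := D (fun q => y (pr q)) v (beta v (x (pr v))).
pose S x y z := g u (a y x u - a y x u') (z (pr u)).
have Ssym x1 y1 z1 : smooth_vfield A x1 -> smooth_vfield A y1 ->
    S x1 y1 z1 = S y1 x1 z1.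
  move=> s1 t1.
  have br v : a y1 x1 v - a x1 y1 v = bracket A x1 y1 (pr v).
    apply: etrans (esym (h_bracket mA cD v (smooth_basic gA s1) (smooth_basic gA t1))) _.
    apply: (lsubmx_bracket gA).
    - by apply: (smooth_beta mA lD rD); exact: smooth_basic.
    - by apply: (smooth_beta mA lD rD); exact: smooth_basic.
    - by move=> q; exact: (betaP mA rD _ _).2.
    - by move=> q; exact: (betaP mA rD _ _).2.
  have e : a y1 x1 u - a x1 y1 u = a y1 x1 u' - a x1 y1 u' by rewrite !br uu'.
  have dE : a y1 x1 u - a y1 x1 u' = a x1 y1 u - a x1 y1 u'.
    have -> : a y1 x1 u = a y1 x1 u' - a x1 y1 u' + a x1 y1 u by rewrite -e subrK.
    by rewrite addrC !addrA addNr add0r addrC.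
  exact: (congr1 (fun w => g u w (z1 (pr u))) dE).
have Santi x1 y1 z1 : smooth_vfield A x1 -> smooth_vfield A y1 ->
    smooth_vfield A z1 -> S x1 y1 z1 = - S x1 z1 y1.
  move=> s1 t1 r1.
  have := mder_beta_constant x1 (metric_basic t1 r1) uu'.
  rewrite (metric_derivative_beta u _ (smooth_basic gA t1) (smooth_basic gA r1)).
  rewrite (metric_derivative_beta u' _ (smooth_basic gA t1) (smooth_basic gA r1)).
  rewrite -!/(a _ _ _) -(metric_riemannian uu') -uu' /S.
  rewrite !(metricDl gA fL) !(metricNl gA fL).
  rewrite (metricC gA fL u (y1 (pr u))) (metricC gA fL u (y1 (pr u))).
  exact: subr_eq_opp.
apply/eqP; rewrite -subr_eq0; apply/eqP; apply: (@metric_nondegenerate u) => z sz.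
rewrite -/(a y x u) -/(a y x u') -/(S x y z).
apply: self_opposite_eq0.
rewrite {1}(Santi x y z sx sy sz) (Ssym x z y sx sz) (Santi z x y sz sx sy).
rewrite (Ssym z y x sz sy) (Santi y z x sy sz sx) (Ssym y x z sy sx).
by rewrite !opprK.
Qed.

(** * The flat Levi-Civita connection *)

(** The connection of M whose derivative along x is read off at one vector over
   each point; by [connection_beta_basic] the choice of that vector is immaterial. *)
Definition base_connection (s : M -> 'rV[R]_n) (p : M) (v : 'rV[R]_n) :=
  D (fun q => s (pr q)) (section_point p) (beta (section_point p) v).

Lemma base_connectionE x s u : smooth_vfield A x -> smooth_vfield A s ->
  base_connection s (pr u) (x (pr u)) =
  D (fun q => s (pr q)) u (beta u (x (pr u))).
Proof.
move=> sx ss.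
exact: (connection_beta_basic sx ss (erefl : pr (section_point (pr u)) = pr u)).
Qed.

Lemma base_connection_field x s : smooth_vfield A x -> smooth_vfield A s ->
  (fun q => base_connection s (pr q) (x (pr q))) =
  (fun q => D (fun q => s (pr q)) q (beta q (x (pr q)))).
Proof. by move=> sx ss; apply/funext => q; exact: base_connectionE. Qed.

Lemma base_connection_linear : linear_connection A A id base_connection.
Proof.
have [h1 h2 h3 h4] := lD.
split.
- move=> s ss p a v w; rewrite /base_connection (beta_linear mA lD rD).
  exact: h1 (smooth_basic gA ss) _ _ _ _.
- move=> s t ss st p v.
  exact: h2 (smooth_basic gA ss) (smooth_basic gA st) _ _.
- move=> h s sh ss p v.
  have e : dfun SA (fun q => h (pr q)) (section_point p) (beta (section_point p) v) =
      dfun A h p v.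
    apply: etrans (mder_proj gA (h : M -> R^o) (section_point p) _) _.
    by rewrite (betaP mA rD _ _).2.
  apply: etrans (h3 _ _ (smooth_fun_basic gA sh) (smooth_basic gA ss) _ _) _.
  exact: (congr1 (fun z : R => z *: s p + h p *: base_connection s p v) e).
- move=> X s sX ss; apply: (smooth_descend gA reference_vector_neq0).
  rewrite (base_connection_field sX ss).
  exact: h4 (smooth_beta mA lD rD (smooth_basic gA sX)) (smooth_basic gA ss).
Qed.

Lemma base_connection_levi_civita :
  levi_civita A (fun p => g (section_point p)) base_connection.
Proof.
split; first exact: base_connection_linear.
- move=> X s t sX ss st p.
  have ss' := smooth_basic gA ss; have st' := smooth_basic gA st.
  apply: etrans (metric_derivative_beta (section_point p) (X p) ss' st').
  have fE : (fun q => g q (s (pr q)) (t (pr q)) : R^o) =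
      (fun q => (fun p => g (section_point p) (s p) (t p)) (pr q)).
    by apply/funext => q; exact: (metric_basic ss st (erefl : pr q = pr (section_point (pr q)))).
  rewrite fE (mder_proj gA (fun p => g (section_point p) (s p) (t p) : R^o)).
  by rewrite (betaP mA rD _ _).2.
- move=> X Y sX sY p.
  have tE Z : (fun q => tmap A A id q (Z q)) = Z.
    by apply/funext => q; exact: (tmap_id gA).
  have br : lsubmx (bracket SA (fun q => beta q (X (pr q)))
      (fun q => beta q (Y (pr q))) (section_point p)) = bracket A X Y p.
    apply: (lsubmx_bracket gA (x := X) (y := Y) (section_point p)).
    - by apply: (smooth_beta mA lD rD); exact: smooth_basic.
    - by apply: (smooth_beta mA lD rD); exact: smooth_basic.
    - by move=> q; exact: (betaP mA rD _ _).2.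
    - by move=> q; exact: (betaP mA rD _ _).2.
  transitivity (base_connection Y p (X p) - base_connection X p (Y p) -
      bracket A X Y p).
    congr (_ - _ - _); last exact: (tmap_id gA).
      exact: (congr1 (fun s => base_connection s p _) (tE Y)).
    exact: (congr1 (fun s => base_connection s p _) (tE X)).
  rewrite -br (h_bracket mA cD (section_point p) (smooth_basic gA sX) (smooth_basic gA sY)).
  by rewrite subrr.
Qed.

(** The bracket of the lifts of X and Y differs from the lift of their bracket by
   a vertical vector, and Z is vertically parallel. *)
Lemma base_connection_flat :
  (forall X Y Z, smooth X -> smooth Y -> smooth Z -> forall u,
    h_curvature A D X Y Z u = 0) ->
  forall X Y Z, smooth_vfield A X -> smooth_vfield A Y -> smooth_vfield A Z ->
    forall p, curvature A base_connection X Y Z p = 0.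
Proof.
move=> flat X Y Z sX sY sZ p.
have sX' := smooth_basic gA sX; have sY' := smooth_basic gA sY.
have sZ' := smooth_basic gA sZ.
pose u := section_point p.
have e1 : base_connection (fun q => base_connection Z q (Y q)) p (X p) =
    D (fun q => D (fun q => Z (pr q)) q (beta q (Y (pr q)))) u (beta u (X p)).
  exact: (congr1 (fun s => D s u _) (base_connection_field sY sZ)).
have e2 : base_connection (fun q => base_connection Z q (X q)) p (Y p) =
    D (fun q => D (fun q => Z (pr q)) q (beta q (X (pr q)))) u (beta u (Y p)).
  exact: (congr1 (fun s => D s u _) (base_connection_field sX sZ)).
have e3 : base_connection Z p (bracket A X Y p) = D (fun q => Z (pr q)) u
    (bracket SA (fun q => beta q (X (pr q))) (fun q => beta q (Y (pr q))) u).
  have br : lsubmx (bracket SA (fun q => beta q (X (pr q)))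
      (fun q => beta q (Y (pr q))) u) = bracket A X Y p.
    apply: (lsubmx_bracket gA (x := X) (y := Y) u).
    - by apply: (smooth_beta mA lD rD); exact: smooth_basic.
    - by apply: (smooth_beta mA lD rD); exact: smooth_basic.
    - by move=> q; exact: (betaP mA rD _ _).2.
    - by move=> q; exact: (betaP mA rD _ _).2.
  move: br; move: (bracket SA _ _ _) => w br.
  have [v e] := horizontal_vertical mA rD u w.
  rewrite e (connectionD cD _ _ _ sZ') (connection_gamma_basic _ _ sZ) addr0 br.
  exact: erefl.
apply: etrans (flat _ _ _ sX' sY' sZ' u).
exact: (congr2 +%R (congr2 (fun a b => - a + b) e1 e2) e3).
Qed.

End Flat.
End Berwald.

Theorem theorem3p17 (R : realType) (n : nat) (M : topologicalType)
    (A : atlas R n M) (L : M -> 'rV[R]_n -> R)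
    (nabla : (slit R n M -> 'rV[R]_n) ->
             slit R n M -> 'rV[R]_(n + n) -> 'rV[R]_n)
    (zeta : slit R n M -> 'rV[R]_n) :
  (3 <= n)%N ->
  smooth_manifold A ->
  finsler A L ->
  cartan_connection A L nabla ->
  h_isotropic A L nabla ->
  concurrent A nabla zeta ->
  (forall X Y Z, smooth_pi_vfield A X -> smooth_pi_vfield A Y ->
     smooth_pi_vfield A Z -> forall u, h_curvature A nabla X Y Z u = 0%R) /\
  (berwald A nabla -> flat_riemannian A L).
Proof.
move=> n3 mA fL cD iso cz; have n2 := ltnW n3.
have flat := isotropic_curvature_eq0 mA fL n2 cD cz iso.
split; first exact: flat.
move=> bD; have rL := metric_riemannian mA fL n2 cD cz bD.
split; first exact: rL.
exists (fun p => finsler_metric L (section_point n2 p)).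
split; first by move=> u; exact: rL.
exists (base_connection A n2 nabla).
  exact: (base_connection_levi_civita mA fL n2 cD cz bD).
exact: (base_connection_flat mA fL n2 cD cz bD flat).
Qed.
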